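(* Fix $p\in(0,1)$ and an integer $k\geq1$. Let $m=m_n$ be any sequence of positive integers, fixed or growing with $n$. If $\pi_n\sim\nu^{(p)}_{n,m_n}$ and $\sigma_n$ is uniform on $S_n$, then, as $n\to\infty$, $$\sup_{0\leq t_1,\ldots,t_k\leq1}\left|\mathbb{P}\left(\frac{L_1(\pi_n)}{n}\leq t_1,\ldots,\frac{L_k(\pi_n)}{n}\leq t_k\right)-\mathbb{P}\left(\frac{L_1(\sigma_n)}{n}\leq t_1,\ldots,\frac{L_k(\sigma_n)}{n}\leq t_k\right)\right|\longrightarrow0.$$ In particular, the ordered large cycle lengths (normalized by $n$) of $\pi_n$ have the same $\operatorname{Poisson\text{--}Dirichlet}(1)$ limit as those of a uniform random permutation.
   Context: Asymmetric shelf shuffle: let $m\ge 1$ be an integer, $p\in(0,1)$, $q=1-p$. A deck of $n$ cards labelled $1,\ldots,n$ from top to bottom is dealt sequentially from the bottom (card $n$ first, card $1$ last). Each card is assigned to one of $m$ labelled shelves independently and uniformly at random, and is placed at the top of the existing pile on that shelf with probability $p$ and at the bottom with probability $q$, independently of everything else. The shuffled deck is formed by joining the piles in shelf order (shelf $1$ on top, then shelf $2$, and so on). The resulting random permutation is $\pi=(\pi_1,\ldots,\pi_n)\in S_n$, where $\pi_i$ is the label of the card in position $i$ from the top, and $\nu^{(p)}_{n,m}$ denotes its law on $S_n$. For a permutation $\pi$, $L_1(\pi)\ge L_2(\pi)\ge\cdots$ denote the cycle lengths of $\pi$ arranged in decreasing order, with $L_j(\pi)=0$ if $j$ exceeds the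 number of cycles. The Poisson–Dirichlet$(1)$ distribution is the law of the decreasing rearrangement of $(V_1,(1-V_1)V_2,(1-V_1)(1-V_2)V_3,\ldots)$ with $V_1,V_2,\ldots$ i.i.d. uniform on $[0,1]$; the limit is in the sense of convergence in distribution of $(L_1/n,\ldots,L_k/n)$ to the first $k$ coordinates. *)

(* Defs.v *)
From mathcomp Require Export all_boot all_order all_algebra all_fingroup.
From mathcomp Require Export finmap.
From mathcomp Require Export all_classical all_reals all_analysis.
Export Order.TTheory GRing.Theory Num.Theory numFieldNormedType.Exports.

Set Implicit Arguments.
Unset Strict Implicit.
Unset Printing Implicit Defensive.

Local Open Scope classical_set_scope.
Local Open Scope ring_scope.

(* Cards, positions and shelves are numbered from 0: [i : 'I_n] is the card
   labelled i+1 (or the position i+1 from the top), [j : 'I_m] is shelf j+1.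
   Piles and decks are listed from top to bottom. *)

(* The random choices made for each card: its shelf, and whether it goes to the
   top ([true]) or to the bottom ([false]) of the pile on that shelf. *)
Definition choices (n m : nat) := {ffun 'I_n -> 'I_m * bool}.

Definition put_card (n m : nat) (w : choices n m)
    (piles : 'I_m -> seq 'I_n) (i : 'I_n) : 'I_m -> seq 'I_n :=
  fun j => if j == (w i).1 then
             if (w i).2 then i :: piles j else rcons (piles j) i
           else piles j.

(* [rev]: the cards are dealt from the bottom of the original deck. *)
Definition final_piles (n m : nat) (w : choices n m) : 'I_m -> seq 'I_n :=
  foldl (put_card w) (fun=> [::]) (rev (enum 'I_n)).

Definition shuffled_deck (n m : nat) (w : choices n m) : seq 'I_n :=
  flatten [seq final_piles w j | j <- enum 'I_m].

Definition choices_prob (R : realType) (p : R) (n m : nat) (w : choices n m) : R :=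
  \prod_(i < n) (m%:R^-1 * (if (w i).2 then p else 1 - p)).

(* nu^(p)_{n,m}({s}); in one-line notation, s i is the card in position i. *)
Definition shelf_law (R : realType) (p : R) (n m : nat) (s : 'S_n) : R :=
  \sum_(w : choices n m | shuffled_deck w == [seq s i | i <- enum 'I_n])
    choices_prob p w.

Definition uniform_law (R : realType) (n : nat) (s : 'S_n) : R := (n`!)%:R^-1.

(* [cycle_len s j] is L_{j+1}(s); fixed points count as cycles. *)
Definition cycle_len (n : nat) (s : 'S_n) (j : nat) : nat :=
  nth 0%N (sort geq [seq #|c| | c : {set 'I_n} in porbits s]) j.

(* (L_1(s)/n, ..., L_k(s)/n) *)
Definition cycle_vec (R : realType) (k n : nat) (s : 'S_n) : 'rV[R]_k :=
  \row_(j < k) ((cycle_len s j)%:R / n%:R).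

Definition cycle_cdf (R : realType) (k n : nat) (law : 'S_n -> R)
    (t : 'rV[R]_k) : R :=
  \sum_(s : 'S_n | [forall j : 'I_k, cycle_vec R k s ord0 j <= t ord0 j]) law s.

Definition cdf_distance (R : realType) (k n : nat) (law law' : 'S_n -> R) : R :=
  sup [set `|cycle_cdf law t - cycle_cdf law' t|
      | t in [set t : 'rV[R]_k | forall j, 0 <= t ord0 j <= 1]].

Definition mutually_independent (d : measure_display) (T : measurableType d)
    (R : realType) (P : probability T R) (V : nat -> {RV P >-> R}) : Prop :=
  forall (J : {fset nat}) (B : nat -> set R), (forall i, measurable (B i)) ->
    P (\bigcap_(i in [set` J]) (V i @^-1` B i))
      = (\prod_(i <- J) P (V i @^-1` B i))%E.

Definition iid_uniform01 (d : measure_display) (T : measurableType d)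
    (R : realType) (P : probability T R) (V : nat -> {RV P >-> R}) : Prop :=
  mutually_independent V /\
  forall i (B : set R), measurable B ->
    distribution P (V i) B = uniform_prob (@ltr01 R) B.

Definition stick_breaking (R : realType) (v : nat -> R) (i : nat) : R :=
  (\prod_(l < i) (1 - v l)) * v i.

Definition decreasing_rearrangement (R : realType) (x y : nat -> R) : Prop :=
  nonincreasing_seq y /\ exists2 tau : nat -> nat, bijective tau & y =1 x \o tau.

(* [D] is the decreasing rearrangement of a uniform stick-breaking sequence, so
   its law is Poisson-Dirichlet(1).  The rearrangement exists almost surely
   (not everywhere: zero pieces can prevent it), whence the a.e. quantifier. *)
Definition poisson_dirichlet1 (d : measure_display) (T : measurableType d)
    (R : realType) (P : probability T R) (D : nat -> {RV P >-> R}) : Prop :=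
  exists2 V : nat -> {RV P >-> R}, iid_uniform01 V &
    {ae P, forall x, decreasing_rearrangement
                       (stick_breaking (fun i => V i x)) (fun i => D i x)}.

(* Convergence in distribution of (L_1/n, ..., L_k/n), under the laws [law n] on
   S_n, to (D_0, ..., D_{k-1}), tested on bounded continuous functions. *)
Definition cycle_vec_cvg_in_law (d : measure_display) (T : measurableType d)
    (R : realType) (P : probability T R) (D : nat -> {RV P >-> R}) (k : nat)
    (law : forall n, 'S_n -> R) : Prop :=
  forall f : 'rV[R]_k -> R, continuous f -> (exists M : R, forall x, `|f x| <= M) ->
    (\sum_(s : 'S_n) law n s * f (cycle_vec R k s))%:E @[n --> \oo]
      --> ('E_P[fun x => f (\row_(j < k) D j x)%R])%E.

(* Main.v *)
Require Import Defs.
From mathcomp Require Import zify ring lra measurable_realfun.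

(** Write [E_n F] for the mean of a function [F] of the list of cycle lengths of
    a random permutation of [n] cards.  The uniform and the shelf law are
    compared through one recursion on [n].

    Deleting the cycle of a uniformly chosen point of a uniform permutation
    gives [n E_n F = sum_(l = 1 .. n) E_(n-l) F(l :: .)]
    ([uniform_mean_recursion]).  The shelf law satisfies the same recursion up to
    an error bounded by a constant that depends on [p] only
    ([shelf_mean_recursion]).  To see this, note that the deck is a sorted
    i.i.d. word: cards are sorted by their letter (the shelf and the choice of
    top or bottom), ties being broken by increasing labels for top and by
    decreasing labels for bottom ([deck_of_sorts]).  Following the cycle of a
    position one reads a periodic sequence of letters, and positions are ordered
    as these sequences are, for a signed lexicographic order.  So the multiset of
    sequences determines the word ([code_count_inj]), as in the bijection of
    Gessel and Reutenauer.  Consequently a pair (word, position [i]) can be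
    recovered after some cycles through positions with the same sequence as [i]
    have been deleted, if one remembers a single period of their letters
    ([encode_inj]).  When one cycle of length [l] equal to the period is deleted,
    the period and the remaining word have the weight of independent words of
    lengths [l] and [n - l], which gives the main term of the recursion.  Otherwise the period is
    repeated at least twice among the deleted letters, which has geometrically
    small probability, because no letter has probability above
    [max p (1 - p) < 1] ([tied_weight_le]).  Injectivity suffices: both sides of
    the recursion have total mass [n], so the mass missed on one side is the mass
    missed on the other.

    If [F] depends only on the cycles longer than [b], the two means agree for
    [n <= b], and induction with the recursions bounds their distance by
    [K / (b + 1)] for every [n], where [K] bounds the error ([long_mean_close]).  With high probability the
    [k] longest cycles are longer than [b] ([few_long_mean_le]).  Letting [n] and
    then [b] grow, the total variation distance between the laws of
    [(L_1, ..., L_k)] tends to zero, uniformly in the number of shelves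
    ([first_parts_close]).  This gives the first assertion, and reduces the
    Poisson-Dirichlet limit to that of uniform permutations.

    For these the recursion says that the cycle lengths are the pieces of a
    discrete stick of length [n], broken repeatedly at a uniform point of what
    remains.  On the probability space that carries the uniform variables [V i],
    breaking the discrete stick with the same variables gives exactly the cycle
    lengths in law ([integral_cuts]), and the pieces divided by [n] converge
    almost surely to the pieces of the continuous stick.  As almost surely
    nothing of the continuous stick is left in the end, the ordered pieces
    converge too ([sorted_cuts_cvg]), and dominated convergence concludes
    ([uniform_cvg_in_law]). *)

Set Implicit Arguments.
Unset Strict Implicit.
Unset Printing Implicit Defensive.
Local Open Scope ring_scope.

(** * Signed sorting of words *)

Section Words.
Local Open Scope nat_scope.
Context (A : finType) (key : A -> nat) (up : A -> bool) (B : nat).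
Context (key_inj : injective key) (keyB : forall a, key a < B).

Definition prec n (w : {ffun 'I_n -> A}) (x y : 'I_n) : bool :=
  (key (w x) < key (w y)) ||
  (w x == w y) && (if up (w x) then x < y else y < x).

(** Equivalently, the inverse of [s] is the signed standardization of [w]:
    positions are compared as the cards they hold. *)
Definition sorts n (w : {ffun 'I_n -> A}) (s : 'S_n) : Prop :=
  forall i j : 'I_n, (i < j) = prec w (s i) (s j).

(** The position of a card is the number of cards that precede it. *)
Lemma sorts_unique n (w : {ffun 'I_n -> A}) (s t : 'S_n) :
  sorts w s -> sorts w t -> s = t.
Proof.
have rankE (u : 'S_n) : sorts w u -> forall i, #|[set x | prec w x (u i)]| = i.
  move=> wu i; transitivity #|[set j : 'I_n | j < i]|.
    rewrite -[RHS](card_imset _ (@perm_inj _ u)); congr (#|pred_of_set _|).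
    apply/setP=> x; rewrite -[x](permKV u) (mem_imset _ _ perm_inj).
    by rewrite !inE wu.
  by rewrite cardsE -sum1_card (big_ord_narrow (ltnW (ltn_ord i))) sum1_card card_ord.
move=> ws wt; apply/permP=> i; 
pose j := (t^-1)%g (s i); have tj : t j = s i by rewrite permKV.
rewrite -[LHS]tj; congr (t _); apply/val_inj.
by rewrite /= -(rankE _ ws i) -tj (rankE _ wt).

Qed.

(** Signed lexicographic order on the letters of [s x, s (s x), ...], made
    numeric by reading them as digits in base [B]; complementing the tail behind
    a letter that is not [up] reverses the order there. *)
Fixpoint code n (w : {ffun 'I_n -> A}) (s : 'I_n -> 'I_n) N (x : 'I_n) : nat :=
  if N is N'.+1 then
    key (w (s x)) * B ^ N' +
    (if up (w (s x)) then code w s N' (s x) else (B ^ N').-1 - code w s N' (s x))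
  else 0.

Lemma code_lt n (w : {ffun 'I_n -> A}) s N x : code w s N x < B ^ N.
Proof.
elim: N x => //= N IH x; rewrite expnS.
have H := keyB (w (s x)); have K := IH (s x).
have : (key (w (s x))).+1 * B ^ N <= B * B ^ N by rewrite leq_mul2r H orbT.
by case: ifP => _; rewrite mulSn; lia.
Qed.

(** The positions [x <= y] hold the cards [s x] and [s y].  Either their letters
    are in the strict order of the leading digits, or they are equal and the
    cards, seen as positions, are in the same or in the opposite order. *)
Lemma code_le n (w : {ffun 'I_n -> A}) (s : 'S_n) N (x y : 'I_n) :
  sorts w s -> x <= y -> code w s N x <= code w s N y.
Proof.
move=> ws; elim: N x y => //= N IH x y.
rewrite leq_eqVlt => /predU1P[/val_inj -> //|]; rewrite ws.
have Hx := code_lt w s N (s x); have Hy := code_lt w s N (s y).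
case/orP=> [lt|/andP[/eqP e]].
  have : (key (w (s x))).+1 * B ^ N <= key (w (s y)) * B ^ N by rewrite leq_mul2r lt orbT.
  by rewrite mulSn; case: ifP => _; case: ifP => _; lia.
by rewrite e; case: ifP => _ /ltnW /IH; lia.
Qed.

Lemma code_inj n1 n2 (w1 : {ffun 'I_n1 -> A}) (w2 : {ffun 'I_n2 -> A}) s1 s2 N x1 x2 :
  code w1 s1 N x1 = code w2 s2 N x2 ->
  forall k, k < N -> w1 (iter k.+1 s1 x1) = w2 (iter k.+1 s2 x2).
Proof.
elim: N x1 x2 => //= N IH x1 x2 E.
have H1 := code_lt w1 s1 N (s1 x1); have H2 := code_lt w2 s2 N (s2 x2).
have BN : 0 < B ^ N by lia.
have e : w1 (s1 x1) = w2 (s2 x2).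
  apply: key_inj; move: (f_equal (fun z => z %/ B ^ N) E).
  by rewrite !divnMDl // !divn_small ?addn0 //; case: ifP => _; lia.
have {}E : code w1 s1 N (s1 x1) = code w2 s2 N (s2 x2).
  by move: E; rewrite e => /addnI; case: ifP => _; lia.
by case=> [|k] kN //; rewrite !iterSr; apply: (IH _ _ E k kN).
Qed.

Lemma code_eq n1 n2 (w1 : {ffun 'I_n1 -> A}) (w2 : {ffun 'I_n2 -> A}) s1 s2 N x1 x2 :
  (forall k, w1 (iter k s1 x1) = w2 (iter k s2 x2)) ->
  code w1 s1 N x1 = code w2 s2 N x2.
Proof.
elim: N x1 x2 => //= N IH x1 x2 E.
have -> := IH (s1 x1) (s2 x2); last by move=> k; rewrite -!iterSr E.
by have /= -> := E 1.
Qed.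

(** Codes are nondecreasing along the positions, so their multiset determines the
    code of each position.  When [N.+1] steps of [s] make whole turns around all
    cycles, the last digit is the letter of the position itself. *)
Lemma code_count_inj n (w1 w2 : {ffun 'I_n -> A}) (s1 s2 : 'S_n) N :
  sorts w1 s1 -> sorts w2 s2 ->
  (forall x, iter N.+1 s1 x = x) -> (forall x, iter N.+1 s2 x = x) ->
  (forall z, \sum_x (code w1 s1 N.+1 x == z) = \sum_x (code w2 s2 N.+1 x == z)) ->
  w1 = w2.
Proof.
move=> ws1 ws2 p1 p2 E.
pose c1 := [seq code w1 s1 N.+1 x | x <- enum 'I_n].
pose c2 := [seq code w2 s2 N.+1 x | x <- enum 'I_n].
have srt w (s : 'S_n) : sorts w s ->
    sorted leq [seq code w s N.+1 x | x <- enum 'I_n].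
  move=> ws; apply: (homo_sorted (e := fun x y : 'I_n => x <= y)).
    by move=> x y; apply: code_le.
  rewrite -(@sorted_map _ _ val leq) val_enum_ord; exact: iota_sorted.
have cnt w (s : 'S_n) z : count_mem z [seq code w s N.+1 x | x <- enum 'I_n] =
     \sum_x (code w s N.+1 x == z).
  by rewrite count_map -sum1_count big_mkcond /= big_enum /=; apply: eq_bigr => x _; case: eqP.
have e : c1 = c2.
  apply: (sorted_eq leq_trans anti_leq); [exact: srt|exact: srt|].
  by apply/allP => z _ /=; rewrite !cnt E.
apply/ffunP=> x.
have xs : nth 0 c1 x = nth 0 c2 x by rewrite e.
have xn : x < size (enum 'I_n) by rewrite size_enum_ord.
move: xs; rewrite !(nth_map x _ _ xn) (nth_ord_enum x x).
by move/code_inj => /(_ N (ltnSn _)); rewrite p1 p2.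
Qed.

End Words.

(** * Deleting cycles and tied positions *)

Section Restriction.
Local Open Scope nat_scope.
Import mathcomp.boot.finset.
Context (n n' : nat) (i0 : 'I_n) (S : {set 'I_n}) (hn : n' + #|S| = n).

(** Positions off [S] are renumbered in increasing order, so that [prec] is
    preserved; [i0] is a mere default value for [nth]. *)
Definition emb (y : 'I_n') : 'I_n := nth i0 (enum (~: S)) y.

Let size_emb : size (enum (~: S)) = n'.
Proof. by rewrite -cardE cardsCs setCK card_ord; lia. Qed.

Lemma emb_notin y : emb y \notin S.
Proof. by rewrite -in_setC -mem_enum mem_nth // size_emb. Qed.

Lemma emb_inj : injective emb.
Proof.
move=> y z /eqP; rewrite nth_uniq ?size_emb ?enum_uniq // => /eqP; exact: val_inj.
Qed.

Lemma emb_surj x : x \notin S -> exists y, emb y = x.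
Proof.
rewrite -in_setC -mem_enum => xS; have xn := xS; rewrite -index_mem size_emb in xn.
by exists (Ordinal xn); rewrite /emb nth_index.
Qed.

Lemma emb_lt y z : (emb y < emb z) = (y < z).
Proof.
have srt : sorted (fun x x' : 'I_n => x < x') (enum (~: S)).
  rewrite {1}/enum_mem; apply: sorted_filter => [? ? ? |]; first exact: ltn_trans.
  by rewrite -(@sorted_map _ _ val ltn) -enumT val_enum_ord iota_ltn_sorted.
have lt (a b : 'I_n') : a < b -> emb a < emb b.
  move=> ab; apply: (sorted_ltn_nth _ i0 srt) => //; rewrite ?inE ?size_emb //.
  by move=> ? ? ?; apply: ltn_trans.
by case: (ltngtP y z) => [/lt //|/lt|/val_inj ->]; rewrite ?ltnn //; lia.
Qed.

Lemma big_emb (R : Type) (idx : R) (op : Monoid.com_law idx) (g : 'I_n -> R) :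
  \big[op/idx]_(x in ~: S) g x = \big[op/idx]_(y < n') g (emb y).
Proof. by rewrite -big_enum (big_nth i0) size_emb big_mkord. Qed.

Lemma perm_restrict (s : 'S_n) : (forall x, x \in S -> s x \in S) ->
  exists t : 'S_n', forall y, emb (t y) = s (emb y).
Proof.
move=> Sst; have sS : s @: S = S.
  by apply/eqP; rewrite eqEcard card_imset ?leqnn ?andbT; [apply/fintype.subsetP=> _ /imsetP[x /Sst xS ->]|apply: perm_inj].
have ex y : exists y', emb y' = s (emb y).
  apply: emb_surj; rewrite -sS (mem_imset _ _ (@perm_inj _ s)); exact: emb_notin.
have [f fE] := boolp.choice ex.
have f_inj : injective f.
  by move=> y z e; apply/emb_inj/(@perm_inj _ s); rewrite -!fE e.
by exists (perm f_inj) => y; rewrite permE.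
Qed.

Lemma emb_iter (s : 'S_n) (t : 'S_n') : (forall y, emb (t y) = s (emb y)) ->
  forall k y, emb (iter k t y) = iter k s (emb y).
Proof. by move=> H; elim=> //= k IH y; rewrite H IH. Qed.

Lemma cycle_sizes_restrict (s : 'S_n) (t : 'S_n') i :
  (forall y, emb (t y) = s (emb y)) -> S = porbit s i ->
  perm_eq [seq #|c| | c : {set 'I_n} in porbits s]
          (#|S| :: [seq #|c| | c : {set 'I_n'} in porbits t]).
Proof.
move=> H SE.
have orb y : emb @: porbit t y = porbit s (emb y).
  apply/setP=> x; apply/imsetP/porbitP.
    by case=> _ /porbitP[k ->] ->; exists k; rewrite !permX (emb_iter H).
  case=> k ->; exists ((t ^+ k)%g y); first exact: mem_porbit.
  by rewrite !permX (emb_iter H).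
have imI : injective (fun c : {set 'I_n'} => emb @: c) := imset_inj emb_inj.
have E : porbits s = S |: [set emb @: c | c : {set 'I_n'} in porbits t].
  apply/setP=> c; rewrite !inE; apply/idP/orP.
    case/imsetP=> x _ ->; case: (boolP (x \in S)) => xS.
      by left; rewrite {1}SE eq_porbit_mem -SE.
    right; have [y yx] := emb_surj xS; apply/imsetP; exists (porbit t y); last by rewrite orb yx.
    exact: imset_f.
  case=> [/eqP ->|/imsetP[_ /imsetP[y _ ->] ->]]; first by rewrite SE imset_f.
  by rewrite orb imset_f.
have SnI : S \notin [set emb @: c | c : {set 'I_n'} in porbits t].
  apply/imsetP=> -[_ /imsetP[y _ ->]]; rewrite orb => SE2.
  by have := emb_notin y; rewrite SE2 porbit_id.
have pe : perm_eq (enum (porbits s)) (S :: [seq emb @: (c : {set 'I_n'}) | c <- enum (porbits t)]).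
  apply: uniq_perm; rewrite ?enum_uniq //=.
    rewrite map_inj_uniq ?enum_uniq // andbT; apply: contra SnI => /mapP[c].
    by rewrite mem_enum => ? ->; apply: imset_f.
  move=> c; rewrite mem_enum E inE in_cons inE; congr (_ || _).
  by apply/imsetP/mapP => -[d dt ->]; exists d => //; rewrite ?mem_enum // -mem_enum.
rewrite /image_mem (permPl (perm_map _ pe)) /= perm_cons -map_comp.
rewrite (@eq_map _ _ _ (fun c : {set 'I_n'} => #|c|)) // => c /=.
by rewrite card_imset //; apply: emb_inj.
Qed.

End Restriction.

Section Ties.
Local Open Scope nat_scope.
Import mathcomp.boot.finset.
Context (A : eqType) (n : nat) (w : 'I_n -> A) (s : 'S_n).

(** Tied positions have the same codes of all lengths: only their mutual order
    distinguishes them. *)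
Definition tie (i j : 'I_n) : bool :=
  `[< forall k, w (iter k s i) = w (iter k s j) >].

Definition ties i : {set 'I_n} := [set j | tie i j].

Lemma tie_refl i : tie i i. Proof. exact/asboolP. Qed.

Lemma tie_sym i j : tie i j -> tie j i.
Proof. by move/asboolP=> H; apply/asboolP=> k. Qed.

Lemma tie_trans i j k : tie i j -> tie j k -> tie i k.
Proof. by move=> /asboolP H /asboolP H'; apply/asboolP=> l; rewrite H. Qed.

Lemma tie_iter i j k : tie i j -> tie (iter k s i) (iter k s j).
Proof. by move/asboolP=> H; apply/asboolP=> l; rewrite -!iterD. Qed.

Lemma iter_order i q : iter (q * #[s]%g) s i = i.
Proof. by rewrite -permX mulnC expgM expg_order expg1n perm1. Qed.

Lemma tie_period_ex i : exists l, (0 < l) && tie i (iter l s i).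
Proof.
by exists #[s]%g; rewrite order_gt0 -[#[s]%g]mul1n iter_order tie_refl.
Qed.

(** A divisor of the length of the cycle of [i], proper when the cycle meets the
    tie class of [i] again on its way. *)
Definition tie_period i := ex_minn (tie_period_ex i).

Lemma tie_period_gt0 i : 0 < tie_period i.
Proof. by rewrite /tie_period; case: ex_minnP => l /andP[]. Qed.

Lemma tie_iter_period i q : tie i (iter (q * tie_period i) s i).
Proof.
elim: q => [|q IH]; first exact: tie_refl.
rewrite mulSn iterD; apply: tie_trans (tie_iter (tie_period i) IH).
by rewrite /tie_period; case: ex_minnP => l /andP[].
Qed.

Lemma tie_period_min i l : 0 < l -> tie i (iter l s i) -> tie_period i <= l.
Proof. by move=> l0 t; rewrite /tie_period; case: ex_minnP => m _; apply; rewrite l0. Qed.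

Lemma letter_period i k : w (iter k s i) = w (iter (k %% tie_period i) s i).
Proof.
have /asboolP/(_ (k %% tie_period i)) := tie_iter_period i (k %/ tie_period i).
by rewrite -iterD addnC -divn_eq.
Qed.

Section Big.
Context (i : 'I_n) (S : {set 'I_n}).
Context (Sst : forall x, x \in S -> s x \in S).
Context (Sgen : forall x, x \in S -> exists k, exists2 t, t \in S :&: ties i & x = iter k s t).

Lemma stable_iter k x : x \in S -> iter k s x \in S.
Proof. by elim: k => //= k IH /IH; apply: Sst. Qed.

(** The tie classes of [i, s i, ..., s^(l-1) i], with [l] the tie period, are
    disjoint by minimality of [l], and [s] maps each class onto the next.  So [S]
    splits into [l] translates of its part tied with [i]. *)
Lemma big_ties (R : Type) (idx : R) (op : Monoid.com_law idx) (g : 'I_n -> R) :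
  \big[op/idx]_(x in S) g x =
  \big[op/idx]_(k < tie_period i) \big[op/idx]_(t in S :&: ties i) g (iter k s t).
Proof.
pose h (p : 'I_(tie_period i) * 'I_n) := iter p.1 s p.2.
pose D := [set p : 'I_(tie_period i) * 'I_n | p.2 \in S :&: ties i].
have SD : S = h @: D.
  apply/setP=> x; apply/idP/imsetP.
    case/Sgen=> k [t]; rewrite inE => /andP[tS]; rewrite inE => ti ->.
    exists (Ordinal (ltn_pmod k (tie_period_gt0 i)), iter (k %/ tie_period i * tie_period i) s t); last first.
      by rewrite /h /= -iterD addnC -divn_eq.
    rewrite !inE stable_iter //=; apply: tie_trans (tie_iter_period i (k %/ tie_period i)) _.
    exact: tie_iter.
  by case=> -[k t]; rewrite !inE /= => /andP[tS ti] ->; apply: stable_iter.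
rewrite [in LHS]SD big_imset /=; last first.
  have aux (k l : nat) (t u : 'I_n) : tie i t -> tie i u -> k <= l -> l < tie_period i ->
      iter k s t = iter l s u -> k = l /\ t = u.
    move=> it iu kl li e.
    have {}e : t = iter (l - k) s u.
      apply: (@perm_inj _ (s ^+ k)%g); rewrite !permX e -iterD; congr (iter _ s u); lia.
    have : ~~ (0 < l - k).
      apply/negP=> lk; have := tie_period_min lk (l := l - k) (i := i).
      have it' : tie i (iter (l - k) s u) by rewrite -e.
      move/(_ (tie_trans it' (tie_iter _ (tie_sym iu)))); lia.
    move=> lk; have lk0 : l - k = 0 by lia.
    by rewrite e lk0; split=> //; lia.
  move=> [k t] [l u]; rewrite !inE /= => /andP[_ it] /andP[_ iu]; rewrite /h /= => e.
  case: (leqP k l) => [kl|/ltnW lk].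
    by have [/val_inj -> ->] := aux _ _ _ _ it iu kl (ltn_ord l) e.
  by have [/val_inj -> ->] := aux _ _ _ _ iu it lk (ltn_ord k) (esym e).
by rewrite pair_big_dep /=; apply: eq_bigl => -[k t]; rewrite !inE /=.
Qed.

End Big.

Definition tie_rank i := index i (enum (ties i)).

(** One cycle is not enough to encode [i]: if [c] positions are tied with [i], the
    same deletion would arise from [c] choices of [i].  Deleting all the cycles
    that meet the first [tie_rank i + 1] of them makes the number of deleted
    copies exceed the rank ([tie_rank_lt_mult]), so that the rank takes few
    values compared with the probability of so many copies. *)
Definition tie_sat i : {set 'I_n} :=
  \bigcup_(t in ties i | index t (enum (ties i)) <= tie_rank i) porbit s t.

Definition tie_mult i := #|tie_sat i :&: ties i|.

Lemma mem_ties i : i \in ties i. Proof. by rewrite inE tie_refl. Qed.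

Lemma tie_sat_stable i x : x \in tie_sat i -> s x \in tie_sat i.
Proof.
case/bigcupP=> t ti xt; apply/bigcupP; exists t => //.
by case/porbitP: xt => k ->; apply/porbitP; exists k.+1; rewrite !permX.
Qed.

Lemma tie_sat_gen i x : x \in tie_sat i ->
  exists k, exists2 t, t \in tie_sat i :&: ties i & x = iter k s t.
Proof.
case/bigcupP=> t /andP[ti tr] /porbitP[k ->]; exists k; exists t; last by rewrite permX.
by rewrite inE ti andbT; apply/bigcupP; exists t; rewrite ?ti ?porbit_id.
Qed.

Lemma tie_rank_lt_mult i : tie_rank i < tie_mult i.
Proof.
have ri : tie_rank i < size (enum (ties i)) by rewrite index_mem mem_enum mem_ties.
rewrite -(size_takel ri) -(card_uniqP _) ?take_uniq ?enum_uniq //.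
apply/subset_leq_card/fintype.subsetP=> t tt.
have ti : t \in ties i by rewrite -mem_enum (mem_take tt).
rewrite inE ti andbT; apply/bigcupP; exists t; rewrite ?porbit_id // ti /=.
by rewrite -ltnS; apply: index_ltn.
Qed.

Lemma tie_sat_porbit i : tie_mult i = 1 -> tie_sat i = porbit s i.
Proof.
move=> m1; have r0 : tie_rank i = 0 by have := tie_rank_lt_mult i; rewrite m1; lia.
apply/setP=> x; apply/bigcupP/idP.
  case=> t /andP[ti]; rewrite r0 leqn0 => /eqP t0.
  suff -> : t = i by [].
  have : nth i (enum (ties i)) (index t (enum (ties i))) = nth i (enum (ties i)) (tie_rank i) by rewrite t0 r0.
  by rewrite !nth_index // mem_enum ?mem_ties.
by exists i => //; rewrite mem_ties leqnn.
Qed.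

Lemma card_tie_sat i : #|tie_sat i| = tie_period i * tie_mult i.
Proof.
rewrite -sum1_card (big_ties (i := i)); [|exact: tie_sat_stable|exact: tie_sat_gen].
rewrite /=; under eq_bigr do rewrite sum1_card.
by rewrite sum_nat_const card_ord.
Qed.

End Ties.

(** * Finite sums *)

Section FiniteSums.
Import mathcomp.boot.finset.
Context (R : realType).

Lemma sum_by_value (I : finType) (P : pred I) (f : I -> nat) (F : I -> R) M :
  (forall i, P i -> (f i < M)%N) ->
  \sum_(i | P i) F i = \sum_(k < M) \sum_(i | P i && (f i == k)) F i.
Proof.
case: M => [|M] fM.
  by rewrite big_ord0 big_pred0 // => i; apply/negP => /fM.
rewrite (partition_big (fun i => inord (f i) : 'I_M.+1) predT) //=.
apply: eq_bigr => k _; apply: eq_bigl => i; case: (boolP (P i)) => //= Pi.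
apply/eqP/eqP => [<-|fk]; first by rewrite inordK // fM.
by rewrite fk inord_val.
Qed.

Lemma sum_inj_le (X Y : finType) (G : pred X) (phi : X -> Y) (wx : X -> R) (wy : Y -> R) :
  {in G &, injective phi} -> (forall x, G x -> wx x = wy (phi x)) ->
  (forall y, 0 <= wy y) -> \sum_(x | G x) wx x <= \sum_y wy y.
Proof.
move=> inj wE w0; rewrite (eq_bigr _ wE).
rewrite -(@big_imset _ _ _ _ _ phi G wy inj) /=.
by rewrite [leRHS](bigID (mem (phi @: G))) /= lerDl sumr_ge0.
Qed.

(** The matched terms cancel, and what remains lies outside the image of [phi]. *)
Lemma sum_inj_close (X Y : finType) (G : pred X) (phi : X -> Y)
    (wx fx : X -> R) (wy fy : Y -> R) :
  {in G &, injective phi} -> (forall x, G x -> wx x = wy (phi x)) ->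
  (forall x, G x -> fx x = fy (phi x)) ->
  (forall y, 0 <= wy y) -> (forall y, `|fy y| <= 1) ->
  `|\sum_(x | G x) wx x * fx x - \sum_y wy y * fy y| <=
    \sum_y wy y - \sum_(x | G x) wx x.
Proof.
move=> inj wE fE w0 f1.
rewrite (eq_bigr (fun x => wy (phi x) * fy (phi x))); last by move=> x Gx; rewrite wE ?fE.
rewrite [X in _ <= _ - X](eq_bigr _ wE).
rewrite -(@big_imset _ _ _ _ _ phi G (fun y => wy y * fy y) inj) /=.
rewrite -(@big_imset _ _ _ _ _ phi G wy inj) /=.
have split_sum (F : Y -> R) :
    \sum_y F y = \sum_(y in phi @: G) F y + \sum_(y | y \notin phi @: G) F y.
  by rewrite (bigID (mem (phi @: G))).
rewrite !split_sum.
rewrite opprD addrA subrr sub0r normrN [leRHS]addrAC subrr add0r.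
apply: le_trans (ler_norm_sum _ _ _) _; apply: ler_sum => y _.
by rewrite normrM ger0_norm // ler_piMr.
Qed.

Lemma geometric_sum_le (r : R) n : 0 <= r < 1 -> \sum_(k < n) r ^+ k <= (1 - r)^-1.
Proof.
move=> /andP[r0 r1]; have d0 : 0 < 1 - r by lra.
rewrite -(ler_pM2l d0) mulfV ?gt_eqF //.
have := subrX1 r n; have := exprn_ge0 n r0; nra.
Qed.

Lemma arith_geometric_sum_le (r : R) n : 0 <= r < 1 ->
  \sum_(k < n) k.+1%:R * r ^+ k <= (1 - r)^-1 ^+ 2.
Proof.
move=> r01; have /andP[r0 r1] := r01; have d0 : 0 < 1 - r by lra.
rewrite -(ler_pM2l d0) expr2 mulrA mulfV ?gt_eqF // mul1r.
apply: le_trans (geometric_sum_le n r01).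
suff -> : (1 - r) * \sum_(i < n) i.+1%:R * r ^+ i = \sum_(i < n) r ^+ i - n%:R * r ^+ n.
  by rewrite gerBl mulr_ge0 ?ler0n ?exprn_ge0.
elim: n => [|n IH]; first by rewrite !big_ord0 mulr0 mul0r subr0.
by rewrite !big_ord_recr /= mulrDr IH exprS -[n.+1%:R]natr1; ring.
Qed.
End FiniteSums.

(** * Cycle type of a sorted random word *)

Definition cycle_type n (s : 'S_n) : seq nat :=
  sort geq [seq #|c| | c : {set 'I_n} in porbits s].

Lemma cycle_type_restrict n n' i0 (S : {set 'I_n}) (s : 'S_n) (t : 'S_n') i :
  (n' + #|S| = n)%N -> (forall y, emb i0 S (t y) = s (emb i0 S y)) -> S = porbit s i ->
  cycle_type s = sort geq (#|S| :: cycle_type t).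
Proof.
move=> hn H SE.
have geq_total : total geq by move=> x y; apply: leq_total.
have geq_trans : transitive geq by move=> x y z /= yx xz; apply: leq_trans xz yx.
have geq_anti : antisymmetric geq by move=> x y; rewrite andbC; apply: anti_leq.
apply/perm_sortP => //; apply: perm_trans (cycle_sizes_restrict hn H SE) _.
by rewrite perm_cons perm_sym perm_sort.
Qed.

Section Encoding.
Import mathcomp.boot.finset.
Context (A : finType) (key : A -> nat) (up : A -> bool) (B : nat).
Context (key_inj : injective key) (keyB : forall a, (key a < B)%N).
Context (st : forall n, {ffun 'I_n -> A} -> 'S_n).
Context (stP : forall n (w : {ffun 'I_n -> A}), sorts key up w (st w)).

Local Notation word n := {ffun 'I_n -> A}.

Definition subword n n' (i0 : 'I_n) (S : {set 'I_n}) (w : word n) : word n' :=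
  [ffun y => w (emb i0 S y)].

(** Deleting cycles commutes with sorting, since sorting only compares pairs of
    cards. *)
Lemma st_subword n n' i0 (S : {set 'I_n}) (w : word n) : (n' + #|S| = n)%N ->
  (forall x, x \in S -> st w x \in S) ->
  forall y : 'I_n', emb i0 S (st (subword n' i0 S w) y) = st w (emb i0 S y).
Proof.
move=> hn Sst; have [t tE] := perm_restrict i0 hn Sst.
suff H : sorts key up (subword n' i0 S w) t.
  by move=> y; rewrite -(sorts_unique H (stP _)).
move=> y z; rewrite -(emb_lt i0 hn) (stP w) /prec !ffunE -!tE.
by rewrite !(emb_lt i0 hn).
Qed.

Definition period n (p : word n * 'I_n) := tie_period p.1 (st p.1) p.2.
Definition multiplicity n (p : word n * 'I_n) := tie_mult p.1 (st p.1) p.2.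
Definition rank n (p : word n * 'I_n) := tie_rank p.1 (st p.1) p.2.
Definition saturation n (p : word n * 'I_n) := tie_sat p.1 (st p.1) p.2.

Definition encode n l n' (p : word n * 'I_n) : word l * word n' :=
  ([ffun k : 'I_l => p.1 (iter k (st p.1) p.2)],
   subword n' p.2 (saturation p) p.1).

Lemma encode_code n l n' (p : word n * 'I_n) N z :
  period p = l -> (n' + l * multiplicity p = n)%N ->
  (\sum_x (code key up B p.1 (st p.1) N x == z) =
   \sum_(k < l) multiplicity p * (code key up B p.1 (st p.1) N (iter k (st p.1) p.2) == z) +
   \sum_(y < n') (code key up B (subword n' p.2 (saturation p) p.1)
        (st (subword n' p.2 (saturation p) p.1)) N y == z))%N.
Proof.
case: p => w i; rewrite /period /multiplicity /saturation /= => pl hn.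
have hn' : (n' + #|tie_sat w (st w) i| = n)%N by rewrite card_tie_sat pl.
have Sst := @tie_sat_stable _ _ w (st w) i.
rewrite (bigID (mem (tie_sat w (st w) i))) /=; congr addn.
  rewrite (big_ties (w := w) (s := st w) (i := i)); [|exact: Sst|exact: tie_sat_gen].
  rewrite pl; apply: eq_bigr => k _ /=.
  rewrite -sum_nat_const; apply: eq_bigr => t; rewrite !inE => /andP[_ it].
  rewrite (@code_eq _ _ _ _ _ _ w w (st w) (st w) N _ (iter k (st w) i)) // => j.
  by move/(tie_iter k)/tie_sym/asboolP: it => ->.
transitivity (\sum_(x in ~: tie_sat w (st w) i) (code key up B w (st w) N x == z))%N.
  by apply: eq_bigl => x; rewrite inE.
rewrite (big_emb i hn') /=; apply: eq_bigr => y _; congr (nat_of_bool (_ == z)).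
apply: code_eq => k; rewrite ffunE; congr (w _).
by rewrite (emb_iter (st_subword i hn' Sst)).
Qed.

(** The codes of the deleted positions are [e] copies of those of one period, and
    the other positions keep the codes that they have in the smaller word.  So
    both words have the same multiset of codes and coincide; then [i] is the
    position of rank [r] in the tie class described by the period. *)
Lemma encode_inj n l n' e r (p q : word n * 'I_n) :
  (n' + l * e = n)%N ->
  period p = l -> multiplicity p = e -> rank p = r ->
  period q = l -> multiplicity q = e -> rank q = r ->
  encode l n' p = encode l n' q -> p = q.
Proof.
move=> hn pl pe pr ql qe qr [E1 E2].
have letters k : p.1 (iter k (st p.1) p.2) = q.1 (iter k (st q.1) q.2).
  rewrite letter_period [RHS]letter_period -/(period p) -/(period q) pl ql.
  have l0 : (0 < l)%N by rewrite -pl tie_period_gt0.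
  by move/ffunP/(_ (Ordinal (ltn_pmod k l0))): E1; rewrite !ffunE.
(* After a common multiple of both orders every position has come back. *)
pose N := (#[st p.1]%g * #[st q.1]%g).-1.
have NE : N.+1 = (#[st p.1]%g * #[st q.1]%g)%N by rewrite prednK // muln_gt0 !order_gt0.
have wE : p.1 = q.1.
  apply: (@code_count_inj A key up B key_inj keyB n p.1 q.1 (st p.1) (st q.1) N) => //.
  - by move=> x; rewrite NE mulnC iter_order.
  - by move=> x; rewrite NE iter_order.
  move=> z; rewrite (@encode_code n l n' p) ?(@encode_code n l n' q) ?pe ?qe //.
  rewrite E2; congr addn; apply: eq_bigr => k _; congr (_ * nat_of_bool (_ == z))%N.
  by apply: code_eq => j; rewrite -!iterD.
case: p q {E1 E2 pl pe ql qe NE N} wE pr qr letters => w i [w' j] /= <-.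
rewrite /rank /= => ir jr letters; congr pair.
have ij : tie w (st w) i j by apply/asboolP.
have TE : ties w (st w) i = ties w (st w) j.
  by apply/setP=> k; rewrite !inE; apply/idP/idP; apply: tie_trans => //; apply: tie_sym.
have iE : nth i (enum (ties w (st w) i)) r = i.
  by rewrite -ir nth_index // mem_enum mem_ties.
have jE : nth i (enum (ties w (st w) j)) r = j.
  by rewrite -jr nth_index // mem_enum mem_ties.
by rewrite -[LHS]iE TE.
Qed.

Context (R : realType) (alpha : A -> R) (rho : R).
Context (alpha_ge0 : forall a, 0 <= alpha a) (alpha_sum : \sum_a alpha a = 1).
Context (alpha_rho : forall a, alpha a <= rho) (rho1 : rho < 1).

Definition weight n (w : word n) : R := \prod_i alpha (w i).

Lemma weight_ge0 n (w : word n) : 0 <= weight w.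
Proof. exact: prodr_ge0. Qed.

Lemma sum_prod_words (f : A -> R) l :
  \sum_(v : word l) \prod_k f (v k) = (\sum_a f a) ^+ l.
Proof. by rewrite -(bigA_distr_bigA (fun _ => f)) /= prodr_const card_ord. Qed.

Lemma sum_weight n : \sum_(w : word n) weight w = 1.
Proof. by rewrite sum_prod_words alpha_sum expr1n. Qed.

Lemma encode_weight n l n' e (p : word n * 'I_n) :
  (n' + l * e = n)%N -> period p = l -> multiplicity p = e ->
  weight p.1 = (\prod_k alpha ((encode l n' p).1 k)) ^+ e * weight (encode l n' p).2.
Proof.
case: p => w i; rewrite /period /multiplicity /= => hn pl pe.
have hn' : (n' + #|tie_sat w (st w) i| = n)%N by rewrite card_tie_sat pl pe.
rewrite /weight (bigID (mem (tie_sat w (st w) i))) /=; congr (_ * _).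
  rewrite (big_ties (w := w) (s := st w) (i := i)); [|exact: tie_sat_stable|exact: tie_sat_gen].
  rewrite pl -prodrXl; apply: eq_bigr => k _ /=.
  rewrite ffunE -pe -prodr_const; apply: eq_bigr => t; rewrite !inE => /andP[_ it].
  by move/asboolP: it => ->.
transitivity (\prod_(x in ~: tie_sat w (st w) i) alpha (w x)).
  by apply: eq_bigl => x; rewrite inE.
by rewrite (big_emb i hn') /=; apply: eq_bigr => y _; rewrite ffunE.
Qed.

Definition word_mean n (F : seq nat -> R) := \sum_(w : word n) weight w * F (cycle_type (st w)).

Let rho_ge0 : 0 <= rho.
Proof.
case: (pickP (@predT A)) => [a _|A0]; first exact: le_trans (alpha_ge0 a) (alpha_rho a).
by move/eqP: alpha_sum; rewrite big_pred0 // eq_sym oner_eq0.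
Qed.

Lemma sum_alpha_exp e : \sum_a alpha a ^+ e.+1 <= rho ^+ e.
Proof.
rewrite -[leRHS]mul1r -alpha_sum mulr_suml; apply: ler_sum => a _.
by rewrite exprS ler_wpM2l // lerXn2r // nnegrE.
Qed.

(** Each letter of the period is deleted [e.+1] times but summed once, which
    leaves [sum_a alpha a ^+ e.+1 <= rho ^+ e] for each of the [l] letters. *)
Lemma class_weight_le n l e r : (0 < l)%N ->
  \sum_(p : word n * 'I_n | [&& period p == l, multiplicity p == e.+1 & rank p == r])
     weight p.1 <= (rho ^+ e) ^+ l.
Proof.
move=> l0; have rho_e : 0 <= (rho ^+ e) ^+ l by rewrite !exprn_ge0.
case: (leqP (l * e.+1)%N n) => [le_n|gt_n]; last first.
  rewrite big_pred0 // => -[w i]; apply/negP => /and3P[/eqP pl /eqP pe _].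
  have := max_card (mem (tie_sat w (st w) i)).
  rewrite card_tie_sat -/(period (w, i)) -/(multiplicity (w, i)) pl pe card_ord; lia.
have hn : (n - l * e.+1 + l * e.+1 = n)%N by rewrite subnK.
set n' := (n - l * e.+1)%N in hn.
apply: (@le_trans _ _ (\sum_(y : word l * word n') (\prod_k alpha (y.1 k)) ^+ e.+1 * weight y.2)).
  apply: (@sum_inj_le _ _ _ _ (encode l n') (fun p => weight p.1)
    (fun y : word l * word n' => (\prod_k alpha (y.1 k)) ^+ e.+1 * weight y.2)).
  - move=> p q /and3P[/eqP pl /eqP pe /eqP pr] /and3P[/eqP ql /eqP qe /eqP qr].
    exact: (encode_inj hn pl pe pr ql qe qr).
  - by move=> p /and3P[/eqP ? /eqP ? _]; apply: encode_weight.
  - by move=> y; rewrite mulr_ge0 ?exprn_ge0 ?weight_ge0 // prodr_ge0.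
rewrite -(pair_big predT predT (fun (v : word l) (w' : word n') => (\prod_k alpha (v k)) ^+ e.+1 * weight w')) /=.
under eq_bigr do rewrite -mulr_sumr sum_weight mulr1 -prodrXl.
by rewrite (sum_prod_words (fun a => alpha a ^+ e.+1)) lerXn2r ?nnegrE ?exprn_ge0 ?sumr_ge0 ?sum_alpha_exp // => a _; rewrite exprn_ge0.
Qed.

Lemma multiplicity_gt0 n (p : word n * 'I_n) : (0 < multiplicity p)%N.
Proof. exact: leq_ltn_trans (tie_rank_lt_mult _ _ _). Qed.

Lemma period_le n (p : word n * 'I_n) : (period p * multiplicity p <= n)%N.
Proof.
have := max_card (mem (tie_sat p.1 (st p.1) p.2)).
by rewrite card_tie_sat card_ord.
Qed.

(** Sum the bound [class_weight_le] over periods [l.+1], multiplicities [e.+2] and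
    the [e.+2] possible ranks; since [(e.+1) (l.+1) >= l + e.+1] the double series
    is dominated by a product of two convergent ones. *)
Lemma tied_weight_le n :
  \sum_(p : word n * 'I_n | multiplicity p != 1%N) weight p.1 <= (1 - rho)^-1 ^+ 3.
Proof.
rewrite (@sum_by_value _ _ _ (fun p => (period p).-1) _ n); last first.
  move=> p _; have := period_le p; have := multiplicity_gt0 p; have := tie_period_gt0 p.1 (st p.1) p.2.
  by rewrite -/(period p); nia.
apply: (@le_trans _ _ (\sum_(l < n) \sum_(e < n) \sum_(r < e.+2) rho ^+ l * rho ^+ e.+1)).
  apply: ler_sum => l _.
  rewrite (@sum_by_value _ _ _ (fun p => (multiplicity p).-2) _ n); last first.
    move=> p _; have := period_le p; have := multiplicity_gt0 p; have := tie_period_gt0 p.1 (st p.1) p.2.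
    by rewrite -/(period p); nia.
  apply: ler_sum => e _.
  rewrite (@sum_by_value _ _ _ (@rank n) _ e.+2); last first.
    move=> p; have := multiplicity_gt0 p; have := tie_rank_lt_mult p.1 (st p.1) p.2.
    by rewrite -/(rank p) -/(multiplicity p) => ? ? /andP[/andP[/eqP ? _] /eqP]; lia.
  apply: ler_sum => r _.
  apply: (@le_trans _ _ ((rho ^+ e.+1) ^+ l.+1)); last first.
    by rewrite -exprM -exprD ler_wiXn2l ?(ltW rho1) //; nia.
  apply: le_trans (class_weight_le n e.+1 r (ltn0Sn l)); rewrite le_eqVlt; apply/orP; left.
  apply/eqP; apply: eq_bigl => p.
  have := multiplicity_gt0 p; have := tie_period_gt0 p.1 (st p.1) p.2; rewrite -/(period p) => ? ?.
  by apply/andP/and3P => [[/andP[/andP[/eqP ? /eqP ?] /eqP ?] ?]|[/eqP ? /eqP ? ?]]; split=> //; lia.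
have r01 : 0 <= rho < 1 by rewrite rho_ge0 rho1.
have d0 : 0 <= (1 - rho)^-1 by rewrite invr_ge0; move: rho1; lra.
under eq_bigr do [under eq_bigr do rewrite sumr_const card_ord -mulrnAr; rewrite -mulr_sumr].
rewrite -mulr_suml exprS; apply: ler_pM; rewrite ?sumr_ge0 //.
- by move=> *; rewrite exprn_ge0.
- by move=> *; rewrite mulrn_wge0 ?exprn_ge0.
- exact: geometric_sum_le.
apply: le_trans (arith_geometric_sum_le n.+1 r01).
rewrite [leRHS]big_ord_recl /= ler_wpDl ?mulr_ge0 ?exprn_ge0 //.
by apply: ler_sum => e _; rewrite mulr_natl.
Qed.

(** The pairs (word, position) of multiplicity one encode injectively as a word
    of length [j.+1] and a word of length [n - j.+1], with the cycle type of the
    former pair being that of the latter word plus a cycle of length [j.+1].  The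
    unmatched mass is the same on both sides, namely that of the remaining
    pairs. *)
Lemma word_mean_recursion n F : (forall x, `|F x| <= 1) ->
  `|n%:R * word_mean n F - \sum_(j < n) word_mean (n - j.+1) (fun x => F (sort geq (j.+1 :: x)))|
    <= 2 * (1 - rho)^-1 ^+ 3.
Proof.
move=> F1.
pose wF (p : word n * 'I_n) := weight p.1 * F (cycle_type (st p.1)).
have total : \sum_(p : word n * 'I_n) weight p.1 = n%:R.
  rewrite -(pair_big predT predT (fun (w : word n) (_ : 'I_n) => weight w)) /=.
  under eq_bigr do rewrite sumr_const card_ord -mulr_natl.
  by rewrite -mulr_sumr sum_weight mulr1.
have -> : n%:R * word_mean n F = \sum_(p : word n * 'I_n) wF p.
  rewrite -(pair_big predT predT (fun (w : word n) (_ : 'I_n) => weight w * F (cycle_type (st w)))) /=.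
  by under [RHS]eq_bigr do rewrite sumr_const card_ord -mulr_natl; rewrite -mulr_sumr.
have tied := tied_weight_le n.
rewrite (bigID (fun p => multiplicity p == 1%N)) /=.
have dec (G : word n * 'I_n -> R) : \sum_(p | multiplicity p == 1%N) G p =
    \sum_(j < n) \sum_(p | (multiplicity p == 1%N) && (period p == j.+1)) G p.
  rewrite (@sum_by_value _ _ _ (fun p => (period p).-1) _ n).
    apply: eq_bigr => j _; apply: eq_bigl => p; congr (_ && _).
    by have := tie_period_gt0 p.1 (st p.1) p.2; rewrite -/(period p) => ?; apply/idP/idP; lia.
  move=> p; have := period_le p; have := tie_period_gt0 p.1 (st p.1) p.2.
  by rewrite -/(period p); nia.
have dev (j : 'I_n) : `|\sum_(p | (multiplicity p == 1%N) && (period p == j.+1)) wF p -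
     word_mean (n - j.+1) (fun x => F (sort geq (j.+1 :: x)))| <=
   1 - \sum_(p : word n * 'I_n | (multiplicity p == 1%N) && (period p == j.+1)) weight p.1.
  have hn : (n - j.+1 + j.+1 * 1 = n)%N by rewrite muln1 subnK.
  pose wy (y : word j.+1 * word (n - j.+1)) := (\prod_k alpha (y.1 k)) * weight y.2.
  pose fy (y : word j.+1 * word (n - j.+1)) := F (sort geq (j.+1 :: cycle_type (st y.2))).
  have sumy (f : word (n - j.+1) -> R) : \sum_(y : word j.+1 * word (n - j.+1)) wy y * f y.2 =
      \sum_w weight w * f w.
    rewrite -(pair_big predT predT (fun (v : word j.+1) (w : word (n - j.+1)) =>
      (\prod_k alpha (v k)) * weight w * f w)) /=.
    under eq_bigr do (under eq_bigr do rewrite -mulrA; rewrite -mulr_sumr).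
    by rewrite -mulr_suml sum_prod_words alpha_sum expr1n mul1r.
  have -> : 1 = \sum_y wy y.
    rewrite -(sum_weight (n - j.+1)); have := sumy (fun=> 1).
    by under eq_bigr do rewrite mulr1; under [RHS]eq_bigr do rewrite mulr1; move->.
  rewrite /word_mean -(sumy (fun w => F (sort geq (j.+1 :: cycle_type (st w))))).
  apply: (@sum_inj_close _ _ _ _ (encode j.+1 (n - j.+1)) (fun p => weight p.1)
    (fun p => F (cycle_type (st p.1))) wy fy).
  - move=> p q /andP[/eqP pe /eqP pl] /andP[/eqP qe /eqP ql].
    have r0 (p' : word n * 'I_n) : multiplicity p' = 1%N -> rank p' = 0%N.
      by have := tie_rank_lt_mult p'.1 (st p'.1) p'.2; rewrite -/(rank p') -/(multiplicity p'); lia.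
    exact: (encode_inj hn pl pe (r0 _ pe) ql qe (r0 _ qe)).
  - by move=> p /andP[/eqP pe /eqP pl]; rewrite (encode_weight hn pl pe) expr1.
  - move=> p /andP[/eqP pe /eqP pl]; rewrite /fy; congr F.
    have card_S : #|saturation p| = j.+1 by rewrite card_tie_sat -/(period p) -/(multiplicity p) pl pe muln1.
    have hn' : (n - j.+1 + #|saturation p| = n)%N by rewrite card_S subnK.
    have sub := st_subword p.2 hn' (@tie_sat_stable _ _ p.1 (st p.1) p.2).
    by rewrite (cycle_type_restrict hn' sub (tie_sat_porbit pe)) card_S.
  - by move=> y; rewrite mulr_ge0 ?weight_ge0 // prodr_ge0.
  - by move=> y; apply: F1.
rewrite dec addrAC -sumrB; apply: le_trans (ler_normD _ _) _.
rewrite mulr2n mulrDl !mul1r; apply: lerD; last first.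
  apply: le_trans tied; apply: le_trans (ler_norm_sum _ _ _) _.
  by apply: ler_sum => p _; rewrite /wF normrM ger0_norm ?weight_ge0 // ler_piMr ?weight_ge0.
apply: le_trans tied; apply: le_trans (ler_norm_sum _ _ _) _.
apply: le_trans (ler_sum _ (fun j _ => dev j)) _.
rewrite sumrB sumr_const card_ord -dec -total (bigID (fun p => multiplicity p == 1%N)) /=.
by rewrite addrAC subrr add0r.
Qed.

End Encoding.

(** * Cycle type of a uniform permutation *)

Section UniformRecursion.
Import mathcomp.boot.finset.
Context (R : realType).

Lemma card_porbit_gt0 n (s : 'S_n) i : (0 < #|porbit s i|)%N.
Proof. by apply/card_gt0P; exists i; apply: porbit_id. Qed.

Lemma card_porbit_le n (s : 'S_n) i : (#|porbit s i| <= n)%N.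
Proof. by rewrite -[leqRHS]card_ord max_card. Qed.

Definition cycle_word n l (p : 'S_n * 'I_n) : {ffun 'I_l -> 'I_n} :=
  [ffun k : 'I_l => iter k p.1 p.2].

Definition off_cycle n n' (p : 'S_n * 'I_n) : 'S_n' :=
  odflt 1%g [pick t : 'S_n' | [forall y, emb p.2 (porbit p.1 p.2) (t y) ==
                                       p.1 (emb p.2 (porbit p.1 p.2) y)]].

Lemma off_cycleP n n' (p : 'S_n * 'I_n) : (n' + #|porbit p.1 p.2| = n)%N ->
  forall y : 'I_n', emb p.2 (porbit p.1 p.2) (off_cycle n' p y) =
                    p.1 (emb p.2 (porbit p.1 p.2) y).
Proof.
move=> hn; rewrite /off_cycle; case: pickP => [t /forallP tE y|no]; first exact/eqP.
have [|t tE] := @perm_restrict n n' p.2 _ hn p.1.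
  by move=> x /porbitP[k ->]; apply/porbitP; exists k.+1; rewrite expgSr permM.
by have /forallP[] := no t; move=> y; rewrite tE.
Qed.

Lemma removal_inj n l n' (p q : 'S_n * 'I_n) : (n' + l = n)%N -> (0 < l)%N ->
  #|porbit p.1 p.2| = l -> #|porbit q.1 q.2| = l ->
  cycle_word l p = cycle_word l q -> off_cycle n' p = off_cycle n' q -> p = q.
Proof.
case: p q => s i [t j] hn l0 /= sl tl /ffunP E1 E2.
have E (k : nat) : (k < l)%N -> iter k s i = iter k t j.
  by move=> kl; have := E1 (Ordinal kl); rewrite !ffunE.
have ij : i = j by exact: (E 0%N).
clear E1.
move: tl E E2; rewrite -{j}ij => tl E E2.
have SE : porbit s i = porbit t i.
  apply/setP=> x; rewrite !porbit_traject sl tl.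
  by apply/trajectP/trajectP => -[k kl ->]; exists k; rewrite ?E.
congr pair; apply/permP=> x; case: (boolP (x \in porbit s i)) => xS.
  have := xS; rewrite porbit_traject sl => /trajectP[k kl ->].
  rewrite -iterS {1}(E _ kl) -iterS; case: (ltnP k.+1 l) => [/E //|lk].
  have -> : k.+1 = l by lia.
  by rewrite -{1}sl -tl !iter_porbit.
have hs : (n' + #|porbit s i| = n)%N by rewrite sl.
have ht : (n' + #|porbit t i| = n)%N by rewrite tl.
have [y <-] := emb_surj i hs xS.
have /= <- := @off_cycleP n n' (s, i) hs y.
by rewrite [in RHS]SE -(@off_cycleP n n' (t, i) ht y) E2 SE.
Qed.

Definition removal_codes n j :=
  [set y : {ffun 'I_j.+1 -> 'I_n} * 'S_(n - j.+1) | injectiveb y.1].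

Lemma card_removal_codes n (j : 'I_n) : #|removal_codes n j| = n`!.
Proof.
have -> : removal_codes n j =
    setX [set f : {ffun 'I_j.+1 -> 'I_n} | injectiveb f] [set: 'S_(n - j.+1)].
  by apply/setP=> y; rewrite !inE andbT.
by rewrite cardsX card_inj_ffuns !card_ord cardsT card_Sn ffact_fact.
Qed.

Definition cycle_at n j := [set p : 'S_n * 'I_n | #|porbit p.1 p.2| == j.+1].

Lemma card_cycle_at_sum n : (\sum_(j < n) #|cycle_at n j| = n * n`!)%N.
Proof.
have -> : (n * n`! = \sum_(p : 'S_n * 'I_n) 1)%N.
  by rewrite sum1_card card_prod card_Sn card_ord mulnC.
have porb_bound (p : 'S_n * 'I_n) : (#|porbit p.1 p.2|.-1 < n)%N.
  by have := card_porbit_le p.1 p.2; have := card_porbit_gt0 p.1 p.2; lia.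
case: n porb_bound => [|n] porb_bound.
  by rewrite big_ord0 big1 // => -[s []].
rewrite (partition_big (fun p : 'S_n.+1 * 'I_n.+1 => inord #|porbit p.1 p.2|.-1 : 'I_n.+1) predT) //=.
apply: eq_bigr => j _; rewrite -sum1_card; apply: eq_bigl => p; rewrite inE.
have p0 := card_porbit_gt0 p.1 p.2.
apply/eqP/eqP => [->|<-]; first exact: inord_val.
by rewrite inordK ?porb_bound // prednK.
Qed.

Let remove n (j : nat) (p : 'S_n * 'I_n) : {ffun 'I_j.+1 -> 'I_n} * 'S_(n - j.+1) :=
  (cycle_word j.+1 p, off_cycle (n - j.+1) p).

Lemma remove_inj n (j : 'I_n) : {in cycle_at n j &, injective (remove j)}.
Proof.
move=> p q; rewrite !inE => /eqP pj /eqP qj [E1 E2].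
by apply: (removal_inj _ _ pj qj E1 E2); rewrite ?subnK.
Qed.

(** Injectivity makes each class at most as large as its set of codes, and both
    have the same total size [n * n`!]. *)
Lemma remove_image n (j : 'I_n) : remove j @: cycle_at n j = removal_codes n j.
Proof.
have sub (k : 'I_n) : remove k @: cycle_at n k \subset removal_codes n k.
  apply/fintype.subsetP => y /imsetP[p]; rewrite inE => /eqP pk ->; rewrite inE.
  apply/injectiveP => a b; rewrite !ffunE => ab; apply/val_inj/eqP.
  have := uniq_traject_porbit p.1 p.2; rewrite pk => /(nth_uniq p.2) <-; rewrite ?size_traject ?ltn_ord //.
  by rewrite !nth_traject ?ltn_ord //; apply/eqP.
have le (k : 'I_n) : (#|cycle_at n k| <= n`!)%N.
  rewrite -(card_in_imset (@remove_inj n k)) -(card_removal_codes k).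
  exact/subset_leq_card.
apply/eqP; rewrite eqEcard sub /= card_removal_codes card_in_imset; last exact: remove_inj.
have := card_cycle_at_sum n; rewrite (bigD1 j) //= => total.
have : (\sum_(k < n | k != j) #|cycle_at n k| <= n.-1 * n`!)%N.
  apply: (@leq_trans (\sum_(k < n | k != j) n`!)%N); first by apply: leq_sum => k _.
  by rewrite sum_nat_const cardC1 card_ord.
have : (n * n`! = n`! + n.-1 * n`!)%N by case: n {sub le total} j => [[]|n _] //; rewrite mulSn.
by move=> e le'; rewrite -(leq_add2r (n.-1 * n`!)) -e -total leq_add2l.
Qed.

Definition uniform_mean n (F : seq nat -> R) : R := \sum_(s : 'S_n) n`!%:R^-1 * F (cycle_type s).

Lemma uniform_mean_recursion n F :
  n%:R * uniform_mean n F = \sum_(j < n) uniform_mean (n - j.+1) (fun x => F (sort geq (j.+1 :: x))).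
Proof.
have -> : n%:R * uniform_mean n F = \sum_(p : 'S_n * 'I_n) n`!%:R^-1 * F (cycle_type p.1).
  rewrite -(pair_big predT predT (fun (s : 'S_n) (_ : 'I_n) => n`!%:R^-1 * F (cycle_type s))) /=.
  by rewrite /uniform_mean mulr_sumr; apply: eq_bigr => s _; rewrite sumr_const card_ord  mulr_natl.
rewrite (@sum_by_value _ _ _ (fun p => #|porbit p.1 p.2|.-1) _ n); last first.
  by move=> p _; have := card_porbit_le p.1 p.2; have := card_porbit_gt0 p.1 p.2; lia.
apply: eq_bigr => j _.
pose g (y : {ffun 'I_j.+1 -> 'I_n} * 'S_(n - j.+1)) := F (sort geq (j.+1 :: cycle_type y.2)).
transitivity (n`!%:R^-1 * \sum_(p in cycle_at n j) g (remove j p)).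
  rewrite mulr_sumr; apply: eq_big => p.
    by rewrite inE; have := card_porbit_gt0 p.1 p.2; case: #|_|.
  move/eqP => pj; congr (_ * F _).
  have pj' : #|porbit p.1 p.2| = j.+1.
    by have := card_porbit_gt0 p.1 p.2; rewrite -pj; case: #|_|.
  have hn : (n - j.+1 + #|porbit p.1 p.2| = n)%N by rewrite pj' subnK.
  by rewrite (cycle_type_restrict hn (off_cycleP hn) (erefl _)) pj'.
rewrite -(big_imset g (@remove_inj n j)) remove_image /uniform_mean.
have -> : \sum_(y in removal_codes n j) g y =
    \sum_(v : {ffun 'I_j.+1 -> 'I_n} | injectiveb v) \sum_(t : 'S_(n - j.+1)) F (sort geq (j.+1 :: cycle_type t)).
  by rewrite pair_big /=; apply: eq_bigl => y; rewrite inE andbT.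
rewrite sumr_const.
have -> : #|[pred v : {ffun 'I_j.+1 -> 'I_n} | injectiveb v]| = (n ^_ j.+1)%N.
  by rewrite -cardsE card_inj_ffuns !card_ord.
rewrite -mulr_sumr -[X in _ * X]mulr_natl mulrA; congr (_ * _).
rewrite -(ffact_fact (ltn_ord j)) natrM invfM -mulrA mulrCA mulVf ?mulr1 //.
by rewrite pnatr_eq0 -lt0n ffact_gt0.
Qed.

End UniformRecursion.

(** * The shuffled deck is a sorted word *)

Lemma pairwise_rev (T : Type) (r : rel T) (s : seq T) :
  pairwise r (rev s) = pairwise (fun x y => r y x) s.
Proof.
elim: s => //= x s IH; rewrite rev_cons pairwise_rcons IH all_rev //.
Qed.

Section Deck.
Context (m : nat).
Local Notation letter := ('I_m * bool)%type.

(** In the deck the shelves follow each other, and on each shelf the cards that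
    were put on top precede those that were put at the bottom. *)
Definition letter_key (a : letter) : nat := (a.1.*2 + ~~ a.2)%N.
Definition is_top (a : letter) : bool := a.2.

Lemma letter_key_inj : injective letter_key.
Proof.
move=> [j b] [j' b']; rewrite /letter_key /= => e.
have jj : j = j' by apply/val_inj => /=; case: b b' e => [] [] /=; lia.
by congr pair => //; case: b b' e => [] [] //=; rewrite jj; lia.
Qed.

Lemma letter_key_lt a : (letter_key a < m.*2)%N.
Proof. by case: a => j b; rewrite /letter_key /=; have := ltn_ord j; case: b => /=; lia. Qed.

Local Notation before := (prec letter_key is_top).

Lemma prec_asym n (w : choices n m) x y : before w x y -> ~~ before w y x.
Proof.
rewrite /prec negb_or; case/orP => [lt|/andP[/eqP e]].
  rewrite -leqNgt ltnW //=; apply/nandP; left; apply/eqP => e.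
  by rewrite e ltnn in lt.
by rewrite e ltnn eqxx /=; case: ifP => _; lia.
Qed.

Section Piles.
Context (n : nat) (w : choices n m).

(** The labels decrease as the cards are dealt: a new card goes above all higher
    labels or below all of them. *)
Lemma final_pilesE j : final_piles w j =
  [seq i <- enum 'I_n | w i == (j, true)] ++ rev [seq i <- enum 'I_n | w i == (j, false)].
Proof.
rewrite /final_piles foldl_rev; elim: (enum 'I_n) => //= i s IH.
rewrite /put_card {1}IH; case: (w i) => a b /=; rewrite !xpair_eqE [j == a]eq_sym.
case: (a == j) => //=; case: b => //=.
by rewrite rev_cons -rcons_cat -IH.
Qed.

Lemma mem_pile j i : (i \in final_piles w j) = ((w i).1 == j).
Proof.
have mf (b : bool) : (i \in [seq k <- enum 'I_n | w k == (j, b)]) = (w i == (j, b)).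
  by rewrite (mem_filter (fun k => w k == (j, b))) mem_enum andbT.
rewrite final_pilesE mem_cat mem_rev !mf.
by case: (w i) => a [] /=; rewrite !xpair_eqE /= ?andbT ?andbF ?orbF.
Qed.

Lemma mem_deck i : i \in shuffled_deck w.
Proof.
apply/flattenP; exists (final_piles w (w i).1); last by rewrite mem_pile.
by apply/mapP; exists (w i).1; rewrite ?mem_enum.
Qed.

Let enum_lt k : pairwise (fun x y : 'I_k => (x < y)%N) (enum 'I_k).
Proof.
rewrite -(pairwise_map val ltn) val_enum_ord -(sorted_pairwise ltn_trans).
exact: iota_ltn_sorted.
Qed.

Lemma pairwise_pile j : pairwise (before w) (final_piles w j).
Proof.
rewrite final_pilesE pairwise_cat pairwise_rev; apply/and3P; split.
- apply/allrelP => x y; rewrite mem_rev !mem_filter => /andP[/eqP wx _] /andP[/eqP wy _].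
  by rewrite /prec wx wy /letter_key /=; apply/orP; left; lia.
- apply: (sub_in_pairwise (P := [pred x | w x == (j, true)]) _ _ (pairwise_filter _ (enum_lt n))).
    by move=> x y /eqP wx /eqP wy xy; rewrite /prec wx wy eqxx xy orbT.
  exact: filter_all.
- apply: (sub_in_pairwise (P := [pred x | w x == (j, false)]) _ _ (pairwise_filter _ (enum_lt n))).
    by move=> x y /eqP wx /eqP wy xy; rewrite /prec wx wy eqxx xy orbT.
  exact: filter_all.
Qed.

Lemma pairwise_deck : pairwise (before w) (shuffled_deck w).
Proof.
rewrite /shuffled_deck; elim: (enum 'I_m) (enum_lt m) => //= j l IH /andP[/allP jl ll].
rewrite pairwise_cat pairwise_pile IH // andbT andbT.
apply/allrelP => x y; rewrite mem_pile => /eqP wx /flattenP[_ /mapP[j' j'l ->]].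
rewrite mem_pile => /eqP wy; have := jl _ j'l; rewrite /prec /letter_key wx wy => ?.
by apply/orP; left; case: (w x).2; case: (w y).2 => /=; lia.
Qed.

Lemma deck_perm : exists s : 'S_n,
  shuffled_deck w = [seq s i | i <- enum 'I_n] /\ sorts letter_key is_top w s.
Proof.
have irr : irreflexive (before w).
  by move=> x; apply/negbTE/negP => xx; have := prec_asym xx; rewrite xx.
have du := pairwise_uniq irr pairwise_deck.
have dn : size (shuffled_deck w) = n.
  rewrite -[RHS](size_enum_ord n); apply/perm_size/uniq_perm; rewrite ?enum_uniq //.
  by move=> i; rewrite mem_deck mem_enum.
pose f (i : 'I_n) := nth i (shuffled_deck w) i.
have fE (x0 i : 'I_n) : f i = nth x0 (shuffled_deck w) i.
  by apply: set_nth_default; rewrite dn.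
have f_inj : injective f.
  move=> i j; rewrite (fE j) => /eqP; rewrite nth_uniq ?dn // => /eqP; exact: val_inj.
exists (perm f_inj); split.
  have := size_enum_ord n; have := @nth_enum_ord n.
  move: (enum 'I_n) => e nth_e size_e.
  have [x0 _|no] := pickP (@predT 'I_n).
    apply: (@eq_from_nth _ x0) => [|i]; first by rewrite size_map size_e.
    rewrite dn => i_n.
    rewrite (nth_map x0) ?size_e // permE (fE x0); congr (nth _ _ _).
    by rewrite nth_e.
  have n0 : n = 0%N by case: (n) no => // k /(_ ord0).
  by rewrite [LHS]size0nil ?dn // [RHS]size0nil // size_map size_e.
move=> i j; rewrite !permE (fE j i).
have lt (k l : 'I_n) : (k < l)%N -> before w (f k) (f l).
  move=> kl; rewrite (fE k l).
  by apply: (pairwiseP k pairwise_deck) => //; rewrite inE dn.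
rewrite -(fE j i); case: (ltngtP i j) => [/lt -> //|/lt ji|/val_inj ->].
  by symmetry; apply/negbTE/prec_asym.
by rewrite irr.
Qed.

Definition deck_of : 'S_n :=
  odflt 1%g [pick s : 'S_n | shuffled_deck w == [seq s i | i <- enum 'I_n]].

Lemma deck_ofP (s : 'S_n) :
  (shuffled_deck w == [seq s i | i <- enum 'I_n]) = (s == deck_of).
Proof.
have inj (t u : 'S_n) : shuffled_deck w = [seq t i | i <- enum 'I_n] ->
    shuffled_deck w = [seq u i | i <- enum 'I_n] -> t = u.
  move=> -> /eq_in_map E; apply/permP => i; apply: E; exact: mem_enum.
rewrite /deck_of; case: pickP => [t /eqP tE|no].
  by apply/eqP/eqP => [sE|->] //=; exact: inj tE.
by have [t [/eqP]] := deck_perm; rewrite no.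
Qed.

Lemma deck_of_sorts : sorts letter_key is_top w deck_of.
Proof. by have [t [/eqP]] := deck_perm; rewrite deck_ofP => /eqP ->. Qed.

End Piles.

Lemma shelf_law_sum (R : realType) (p : R) n (G : 'S_n -> R) :
  \sum_(s : 'S_n) shelf_law p m s * G s =
  \sum_(w : choices n m) choices_prob p w * G (deck_of w).
Proof.
under eq_bigr do rewrite /shelf_law mulr_suml.
rewrite (exchange_big_dep predT) //=; apply: eq_bigr => w _.
by under eq_bigl do rewrite deck_ofP; rewrite big_pred1_eq.
Qed.

End Deck.

(** * Comparison of the two laws *)

Section Comparison.
Context (R : realType) (p : R) (hp : 0 < p < 1).

Definition letter_prob m (a : 'I_m * bool) : R := m%:R^-1 * (if a.2 then p else 1 - p).

Definition shelf_mean n m (F : seq nat -> R) : R :=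
  \sum_(s : 'S_n) shelf_law p m s * F (cycle_type s).

Definition recursion_const : R := 2 * (1 - Num.max p (1 - p))^-1 ^+ 3.

Lemma letter_prob_ge0 m (a : 'I_m * bool) : 0 <= letter_prob a.
Proof. by rewrite mulr_ge0 ?invr_ge0 ?ler0n //; case: ifP => _; move: hp; lra. Qed.

Lemma sum_letter_prob m : (0 < m)%N -> \sum_(a : 'I_m * bool) letter_prob a = 1.
Proof.
move=> m0; rewrite -(pair_big predT predT (fun (j : 'I_m) (b : bool) => letter_prob (j, b))) /=.
under eq_bigr do rewrite big_bool /letter_prob /= -mulrDr addrCA subrr addr0 mulr1.
by rewrite sumr_const card_ord -[LHS]mulr_natl mulfV // pnatr_eq0 -lt0n.
Qed.

Lemma letter_prob_le m (a : 'I_m * bool) : letter_prob a <= Num.max p (1 - p).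
Proof.
have m1 : (m%:R^-1 : R) <= 1.
  have := ltn_ord a.1; case: m {a} a.1 => // k _ _.
  by rewrite invf_le1 ?ltr0Sn // ler1n.
rewrite /letter_prob -[leRHS]mul1r; apply: ler_pM => //.
- by case: ifP => _; move: hp; lra.
- by rewrite le_max; case: ifP => _; rewrite lexx ?orbT.
Qed.

Lemma max_lt1 : Num.max p (1 - p) < 1.
Proof. by rewrite gt_max; apply/andP; split; move: hp; lra. Qed.

Lemma shelf_meanE n m F :
  shelf_mean n m F = word_mean (fun n (w : choices n m) => deck_of w) (@letter_prob m) n F.
Proof. exact: (@shelf_law_sum m R p n (fun s => F (cycle_type s))). Qed.

Lemma shelf_mean_recursion n m F : (0 < m)%N -> (forall x, `|F x| <= 1) ->
  `|n%:R * shelf_mean n m F -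
    \sum_(j < n) shelf_mean (n - j.+1) m (fun x => F (sort geq (j.+1 :: x)))| <= recursion_const.
Proof.
move=> m0 F1; rewrite shelf_meanE; under eq_bigr do rewrite shelf_meanE.
exact: (@word_mean_recursion _ _ _ _ (@letter_key_inj m) (@letter_key_lt m) _
  (fun n (w : choices n m) => deck_of_sorts w) _ _ _ (@letter_prob_ge0 m)
  (sum_letter_prob m0) (@letter_prob_le m) max_lt1).
Qed.

Lemma recursion_const_ge0 : 0 <= recursion_const.
Proof. by rewrite mulr_ge0 ?ler0n ?exprn_ge0 // invr_ge0 subr_ge0 (ltW max_lt1). Qed.

Lemma shelf_law_ge0 n m (s : 'S_n) : 0 <= shelf_law p m s.
Proof. by apply: sumr_ge0 => w _; apply: prodr_ge0 => i _; apply: letter_prob_ge0. Qed.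

Lemma sum_shelf_law n m : (0 < m)%N -> \sum_(s : 'S_n) shelf_law p m s = 1.
Proof.
move=> m0; have := @shelf_law_sum m R p n (fun=> 1).
under eq_bigr do rewrite mulr1; under [in RHS]eq_bigr do rewrite mulr1; move=> ->.
by rewrite -(sum_weight (sum_letter_prob m0) n).
Qed.

Lemma sum_uniform_law n : \sum_(s : 'S_n) (n`!%:R^-1 : R) = 1.
Proof.
by rewrite sumr_const card_Sn -[LHS]mulr_natl mulfV // pnatr_eq0 -lt0n fact_gt0.
Qed.

Lemma cycle_type_le n (s : 'S_n) : all (fun c => c <= n)%N (cycle_type s).
Proof.
rewrite /cycle_type all_sort; apply/allP => _ /mapP[c _ ->].
by rewrite -[leqRHS]card_ord max_card.
Qed.

Lemma geq_total : total geq. Proof. by move=> x y; apply: leq_total. Qed.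
Lemma geq_trans : transitive geq. Proof. by move=> x y z /= yx xz; apply: leq_trans xz yx. Qed.

Lemma sum_above n b : (\sum_(j < n) (b < n - j.+1) = n - b.+1)%N.
Proof.
rewrite (reindex_inj rev_ord_inj) /=.
transitivity (\sum_(j < n) (b < j))%N.
  by apply: eq_bigr => j _; congr (nat_of_bool (b < _)%N); have := ltn_ord j; lia.
by elim: n => [|n IH]; rewrite ?big_ord0 // big_ord_recr /= IH; lia.
Qed.

Definition long_parts b (x : seq nat) := [seq c <- x | (b < c)%N].

(** For [n <= b] there is no long cycle.  For [n > b], with [K] the constant of the
    recursion, induction gives a distance of at most
    [(K + (n - b.+1) * (K / b.+1)) / n], where [n - b.+1] counts the smaller sizes
    above [b]; this is exactly [K / b.+1]. *)
Lemma long_mean_close n m b H : (0 < m)%N -> (forall x, `|H x| <= 1) ->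
  `|shelf_mean n m (fun x => H (long_parts b x)) - uniform_mean n (fun x => H (long_parts b x))|
    <= recursion_const / b.+1%:R * (b < n)%N%:R.
Proof.
move=> m0; elim/ltn_ind: n H => n IH H H1.
case: (ltnP b n) => [bn|nb]; last first.
  have short s : long_parts b (@cycle_type n s) = [::].
    apply/eqP; rewrite -[_ == _]negbK -has_filter; apply/hasPn => c cs.
    by rewrite -leqNgt; apply: leq_trans (allP (cycle_type_le s) _ cs) nb.
  rewrite /shelf_mean /uniform_mean; under eq_bigr do rewrite short.
  under [X in _ - X]eq_bigr do rewrite short.
  by rewrite -!mulr_suml sum_shelf_law // sum_uniform_law subrr normr0 mulr0.
rewrite mulr1; set d := recursion_const / _.
have d0 : 0 <= d by rewrite divr_ge0 ?recursion_const_ge0.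
have n0 : 0 < n%:R :> R by rewrite ltr0n; lia.
pose Hj j x := H (sort geq (if (b < j.+1)%N then j.+1 :: x else x)).
have HjE j x : H (long_parts b (sort geq (j.+1 :: x))) = Hj j (long_parts b x).
  by rewrite /long_parts (filter_sort geq_total geq_trans) /= /Hj; case: ifP.
have := @shelf_mean_recursion n m _ m0 (fun x => H1 (long_parts b x)).
have := @uniform_mean_recursion R n (fun x => H (long_parts b x)).
under eq_bigr do under eq_fun do rewrite HjE.
under [in X in _ -> X]eq_bigr do under eq_fun do rewrite HjE.
set S := shelf_mean _ _ _; set U := uniform_mean _ _ => eU eS.
have : `|n%:R * S - n%:R * U| <= recursion_const + (n - b.+1)%:R * d.
  rewrite eU; set T := \sum_(j < n) shelf_mean _ _ _ in eS.
  rewrite -[X in X - _](subrK T) -addrA; apply: le_trans (ler_normD _ _) _.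
  apply: lerD => //; rewrite -sumrB; apply: le_trans (ler_norm_sum _ _ _) _.
  rewrite -sum_above natr_sum mulr_suml; apply: ler_sum => j _.
  rewrite mulrC; apply: IH; first by have := ltn_ord j; lia.
  by move=> x; apply: H1.
rewrite -mulrBr normrM gtr0_norm // => le_nd.
rewrite -(ler_pM2l n0); apply: le_trans le_nd _.
have -> : recursion_const = b.+1%:R * d by rewrite /d mulrC divfK // pnatr_eq0.
by rewrite -mulrDl -natrD subnKC.
Qed.

Definition few_long b k (x : seq nat) : R := (size (long_parts b x) < k)%N%:R.

Lemma uniform_mean_le1 n F : (forall x, F x <= 1) -> @uniform_mean R n F <= 1.
Proof.
move=> F1; rewrite -(sum_uniform_law n); apply: ler_sum => s _.
by rewrite ler_piMr ?invr_ge0.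
Qed.

(** The cycle of a random point is long except with probability [b / n], and what
    it leaves has a uniform size; apply induction on [k] to the remainder, which
    is large with high probability. *)
Lemma few_long_mean_le b k (e : R) : 0 < e ->
  exists N, forall n, (N <= n)%N -> uniform_mean n (few_long b k) <= e.
Proof.
elim: k e => [|k IH] e e0.
  exists 0%N => n _; rewrite /uniform_mean big1 ?(ltW e0) // => s _.
  by rewrite /few_long ltn0 mulr0.
have e2 : 0 < e / 2 by rewrite divr_gt0.
have [N NE] := IH _ e2.
pose M := Num.Def.truncn ((b + N)%:R / (e / 2)).
exists (maxn M.+1 1) => n; rewrite geq_max => /andP[nM n1].
have n0 : 0 < n%:R :> R by rewrite ltr0n.
rewrite -(ler_pM2l n0) uniform_mean_recursion.
have step (j : 'I_n) : uniform_mean (n - j.+1) (fun x => few_long b k.+1 (sort geq (j.+1 :: x)))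
    <= (j < b)%N%:R + (n - j.+1 < N)%N%:R + e / 2.
  have low : 0 <= (n - j.+1 < N)%N%:R + e / 2 :> R by rewrite addr_ge0 ?ler0n ?(ltW e2).
  case: (ltnP j b) => jb.
    apply: (@le_trans _ _ 1); last by rewrite -addrA lerDl.
    by apply: uniform_mean_le1 => x; rewrite /few_long; case: (_ < _)%N.
  have -> : (fun x => few_long b k.+1 (sort geq (j.+1 :: x))) = few_long b k.
    apply/funext => x; rewrite /few_long /long_parts (filter_sort geq_total geq_trans).
    by rewrite size_sort /= [(b < j.+1)%N]ltnS jb /= ltnS.
  rewrite add0r; case: (ltnP (n - j.+1) N) => jN; last by rewrite add0r NE.
  apply: (@le_trans _ _ 1); last by rewrite lerDl ltW.
  by apply: uniform_mean_le1 => x; rewrite /few_long; case: (_ < _)%N.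
apply: le_trans (ler_sum _ (fun j _ => step j)) _.
rewrite !big_split /= sumr_const card_ord -mulr_natl.
have lt_sum (c : nat) : (\sum_(j < n) (j < c) <= c)%N.
  suff -> : (\sum_(j < n) (j < c) = minn n c)%N by exact: geq_minr.
  by elim: n {nM n1 n0 step} => [|n IHn]; rewrite ?big_ord0 ?min0n // big_ord_recr /= IHn; lia.
have h1 : \sum_(j < n) ((j < b)%N%:R : R) <= b%:R by rewrite -natr_sum ler_nat.
have h2 : \sum_(j < n) ((n - j.+1 < N)%N%:R : R) <= N%:R.
  rewrite -natr_sum ler_nat (reindex_inj rev_ord_inj) /=.
  apply: leq_trans (lt_sum N); apply: leq_sum => j _.
  by have -> : (n - (n - j.+1).+1 = j)%N by have := ltn_ord j; lia.
have h3 : (b + N)%:R <= n%:R * (e / 2).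
  rewrite -ler_pdivrMr //; apply: ltW; apply: lt_le_trans (truncnS_gt _) _.
  by rewrite ler_nat.
move: h1 h2 h3; rewrite natrD; set A := \sum_(j < n) _; set C := \sum_(j < n) _; lra.
Qed.

Definition depends_on_first k (F : seq nat -> R) :=
  forall x y, (forall j, (j < k)%N -> nth 0%N x j = nth 0%N y j) -> F x = F y.

Lemma nth_long_parts b k x j : sorted geq x ->
  (k <= size (long_parts b x))%N -> (j < k)%N -> nth 0%N (long_parts b x) j = nth 0%N x j.
Proof.
rewrite /long_parts.
elim: x k j => [|c x IH] k j //= srt.
case: (ltnP b c) => [bc|cb] /=.
  case: j => //= j; case: k => // k; rewrite !ltnS => kx jk.
  by apply: IH kx jk; apply: path_sorted srt.
have -> : [seq c0 <- x | (b < c0)%N] = [::].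
  apply/eqP; rewrite -[_ == _]negbK -has_filter; apply/hasPn => d dx.
  rewrite -leqNgt; apply: leq_trans cb.
  by move: srt; rewrite (path_sortedE geq_trans) => /andP[/allP/(_ _ dx)].
by rewrite leqn0 => /eqP ->.
Qed.

(** Total variation bound for the [k] longest cycles: replace them by the longest
    among the cycles above [b], at a cost controlled by [few_long_mean_le], and
    compare the latter by [long_mean_close]. *)
Lemma first_parts_close k (e : R) : 0 < e ->
  exists N, forall n m F, (N <= n)%N -> (0 < m)%N -> depends_on_first k F ->
    (forall x, `|F x| <= 1) -> `|shelf_mean n m F - uniform_mean n F| <= e.
Proof.
move=> e0.
pose b := Num.Def.truncn (recursion_const / (e / 8)).
(* Passing to the long parts costs 2 units of [e / 8] under the uniform law and 4
   under the shelf law; comparing the long parts costs one more. *)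
have e8 : 0 < e / 8 by rewrite divr_gt0.
have [N NE] := @few_long_mean_le b k _ e8.
exists N => n m F nN m0 Fk F1.
have dle : recursion_const / b.+1%:R <= e / 8.
  rewrite ler_pdivrMr ?ltr0n // mulrC -ler_pdivrMr //.
  by apply: ltW; apply: truncnS_gt.
have close H : (forall x, `|H x| <= 1) ->
    `|shelf_mean n m (fun x => H (long_parts b x)) - uniform_mean n (fun x => H (long_parts b x))| <= e / 8.
  move=> H1; apply: le_trans (long_mean_close n b m0 H1) _; apply: le_trans dle.
  by rewrite ler_piMr ?divr_ge0 ?recursion_const_ge0 // lern1; case: (b < n)%N.
have few01 x : 0 <= few_long b k x <= 1 by rewrite /few_long; case: (_ < _)%N; rewrite ?lexx ?ler01.
have F_long (s : 'S_n) : `|F (cycle_type s) - F (long_parts b (cycle_type s))| <=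
    2 * few_long b k (cycle_type s).
  rewrite /few_long; case: (ltnP (size _) k) => sk.
    by rewrite mulr1; apply: le_trans (ler_normB _ _) _; rewrite (natrD _ 1 1) lerD.
  rewrite (Fk _ (long_parts b (cycle_type s))) ?subrr ?normr0 ?mulr0 // => j jk.
  rewrite (nth_long_parts _ sk jk) //; exact: (sort_sorted geq_total).
have uF : `|uniform_mean n F - uniform_mean n (fun x => F (long_parts b x))| <= 2 * uniform_mean n (few_long b k).
  rewrite /uniform_mean -sumrB mulr_sumr; apply: le_trans (ler_norm_sum _ _ _) _.
  apply: ler_sum => s _; rewrite -mulrBr normrM ger0_norm ?invr_ge0 // mulrCA.
  by rewrite ler_wpM2l ?invr_ge0.
have sF : `|shelf_mean n m F - shelf_mean n m (fun x => F (long_parts b x))| <=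
    2 * shelf_mean n m (few_long b k).
  rewrite /shelf_mean -sumrB mulr_sumr; apply: le_trans (ler_norm_sum _ _ _) _.
  apply: ler_sum => s _; rewrite -mulrBr normrM ger0_norm ?shelf_law_ge0 // mulrCA.
  by rewrite ler_wpM2l ?shelf_law_ge0.
have few_close := close (fun y => (size y < k)%N%:R).
have {}few_close : `|shelf_mean n m (few_long b k) - uniform_mean n (few_long b k)| <= e / 8.
  by apply: few_close => x; rewrite ger0_norm ?ler0n // lern1; case: (_ < _)%N.
have := close F F1; have := NE n nN; move: uF sF few_close.
rewrite !ler_norml; lra.
Qed.

End Comparison.

(** * Discrete stick breaking *)

Section DiscreteSticks.
Context (R : realType).

(** Zeros are ignored because the stick of length [n] is always broken [n] times,
    the last pieces being zero once it is exhausted. *)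
Definition parts_invariant (F : seq nat -> R) :=
  forall x y, perm_eq (long_parts 0 x) (long_parts 0 y) -> F x = F y.

Lemma nth_nonzero_parts x j : sorted geq x -> nth 0%N (long_parts 0 x) j = nth 0%N x j.
Proof.
rewrite /long_parts; elim: x j => [|c x IH] j //= srt.
case: c srt => [|c] srt /=; last by case: j => //= j; apply: IH; apply: path_sorted srt.
move: srt; rewrite (path_sortedE geq_trans) => /andP[/allP x0 _].
have -> : [seq c <- x | (0 < c)%N] = [::].
  by apply/eqP; rewrite -[_ == _]negbK -has_filter; apply/hasPn => d /x0 /=; rewrite -leqNgt.
rewrite nth_nil; case: j => //= j; case: (ltnP j (size x)) => jx; last by rewrite nth_default.
by have := x0 _ (mem_nth 0%N jx); rewrite /= leqn0 => /eqP ->.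
Qed.

Lemma parts_invariant_sort k F : depends_on_first k F -> parts_invariant (fun x => F (sort geq x)).
Proof.
move=> Fk x y xy; apply: Fk => j _.
have srt z : sorted geq (sort geq z) := sort_sorted geq_total z.
rewrite -(nth_nonzero_parts _ (srt x)) -(nth_nonzero_parts _ (srt y)) /long_parts.
rewrite !(filter_sort geq_total geq_trans); congr nth; apply/perm_sortP => //.
- exact: geq_total.
- exact: geq_trans.
- by move=> a b; rewrite andbC; apply: anti_leq.
Qed.

Definition piece_prob (N c : nat) : R :=
  if N is 0 then (c == 0)%N%:R else (0 < c <= N)%N%:R / N%:R.

(** The law of the successive pieces, unrolled from [uniform_mean_recursion]. *)
Fixpoint pieces_prob (n : nat) (mu : seq nat) : R :=
  if mu is c :: mu' then piece_prob n c * pieces_prob (n - c) mu' else 1.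

Fixpoint bounded_lists (M f : nat) : seq (seq nat) :=
  if f is f'.+1 then [seq c :: mu | c <- iota 0 M.+1, mu <- bounded_lists M f'] else [:: [::]].

Lemma uniform_mean0 F : uniform_mean 0 F = F [::] :> R.
Proof.
have nil s : @cycle_type 0 s = [::].
  case E: (cycle_type s) => [//|c x].
  have : c \in cycle_type s by rewrite E mem_head.
  by rewrite /cycle_type mem_sort => /mapP[b]; rewrite mem_enum => /imsetP[[]].
rewrite /uniform_mean; under eq_bigr do rewrite nil.
by rewrite -mulr_suml sum_uniform_law mul1r.
Qed.

Lemma uniform_mean_pieces M f n F : parts_invariant F -> (n <= f)%N -> (n <= M)%N ->
  uniform_mean n F = \sum_(mu <- bounded_lists M f) pieces_prob n mu * F mu.
Proof.
elim: f n F => [|f IH] n F Finv.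
  by rewrite leqn0 => /eqP -> _; rewrite uniform_mean0 big_seq1 mul1r.
have Finvc c : parts_invariant (fun x => F (c :: x)).
  by move=> x y xy; apply: Finv; rewrite /long_parts /=; case: ifP; rewrite ?perm_cons.
move=> nf nM; rewrite big_allpairs_dep /=.
under eq_bigr do (under eq_bigr do rewrite -mulrA; rewrite -mulr_sumr).
case: n nf nM => [|n] nf nM.
  rewrite big_cons /= mul1r [X in _ + X]big1_seq ?addr0.
    transitivity (uniform_mean 0 (fun x => F (0%N :: x))); last exact: (IH 0%N _ (Finvc 0%N)).
    by rewrite !uniform_mean0; apply: Finv.
  by case=> [|c]; rewrite ?mem_iota /= ?andbF // mul0r.
have n0 : n.+1%:R != 0 :> R by rewrite pnatr_eq0.
apply: (mulfI n0); rewrite uniform_mean_recursion.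
have -> : 0%N :: iota 1 M = index_iota 0 M.+1 by rewrite /index_iota subn0.
rewrite (big_cat_nat _ (n := n.+2)) //= [X in _ + X]big_nat_cond [X in _ + X]big1 ?addr0; last first.
  move=> c /andP[/andP[nc _] _]; rewrite (_ : (0 < c <= n.+1)%N = false) ?mul0r ?mulr0 //; lia.
rewrite big_nat_recl //= !mul0r add0r mulr_sumr big_mkord; apply: eq_bigr => j _.
rewrite ltn_ord mul1r mulrA mulfV // mul1r.
rewrite -(IH _ (fun x => F (j.+1 :: x))) //; [|lia|lia].
rewrite /uniform_mean; apply: eq_bigr => s _; congr (_ * _); apply: Finv.
apply: perm_filter; exact: permEl (perm_sort _ _).
Qed.

(** One plus the integer part of [N x], so that a uniform [x] gives a uniform
    piece in [1 .. N]; the minimum only matters outside [0 <= x < 1]. *)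
Definition piece (N : nat) (x : R) : nat :=
  if N is N'.+1 then (minn (Num.Def.truncn (N%:R * x)) N').+1 else 0.

Section Fixed.
Context (n : nat) (v : nat -> R).

Fixpoint remaining (l : nat) : nat :=
  if l is l'.+1 then remaining l' - piece (remaining l') (v l') else n.

Definition cut l := piece (remaining l) (v l).

Definition cuts f := [seq cut l | l <- iota 0 f].

Lemma piece_le N x : (piece N x <= N)%N.
Proof. by case: N => //= N; rewrite ltnS geq_minr. Qed.

Lemma cuts_eqP mu f : size mu = f ->
  (cuts f = mu) <->
  (forall l, (l < f)%N -> piece (n - sumn (take l mu)) (v l) = nth 0%N mu l).
Proof.
move=> sz.
have remainingE l : (l <= f)%N -> (forall i, (i < l)%N -> cut i = nth 0%N mu i) ->
    remaining l = (n - sumn (take l mu))%N.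
  elim: l => [|l IH] lf H; first by rewrite take0 subn0.
  have := H l (ltnSn l); rewrite (take_nth 0%N) ?sz // sumn_rcons /= /cut => ->.
  rewrite subnDA IH ?(ltnW lf) // => i il; apply: H; lia.
split=> [E l lf|E].
  have H i : (i < f)%N -> cut i = nth 0%N mu i.
    by move=> i_f; rewrite -E (nth_map 0%N) ?size_iota // nth_iota.
  rewrite -remainingE ?(ltnW lf) //; first exact: (H l).
  by move=> i il; apply: H; lia.
apply: (@eq_from_nth _ 0%N); rewrite size_map size_iota // => l lf.
rewrite (nth_map 0%N) ?size_iota // nth_iota // add0n.
elim/ltn_ind: l lf => l IH lf; rewrite /cut remainingE ?(ltnW lf) ?E //.
by move=> i il; apply: IH; lia.
Qed.

Lemma piece_prob_prod f mu : size mu = f -> 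
  pieces_prob n mu = \prod_(l < f) piece_prob (n - sumn (take l mu)) (nth 0%N mu l).
Proof.
move=> <-; elim: mu n => [|c mu IH] N /=; first by rewrite big_ord0.
rewrite big_ord_recl /= subn0 IH; congr (_ * _); apply: eq_bigr => l _.
by rewrite subnDA.
Qed.

Context (v01 : forall l, 0 <= v l <= 1).

Lemma piece_approx N (x : R) : 0 <= x <= 1 -> `|(piece N x)%:R - N%:R * x| <= 1.
Proof.
case: N => [|N] x01; first by rewrite /= mul0r subrr normr0.
rewrite /piece; set y := N.+1%:R * x.
have y0 : 0 <= y by rewrite /y mulr_ge0; case/andP: x01.
have yN : y <= N.+1%:R by rewrite /y ler_piMr; case/andP: x01.
have /andP[ty yt] := Num.Theory.truncn_itv y0.
case: (leqP (Num.Def.truncn y) N) => tN.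
  by rewrite ler_norml; move: ty yt; rewrite -natr1; lra.
have : N.+1%:R <= (Num.Def.truncn y)%:R :> R by rewrite ler_nat.
by rewrite ler_norml; lra.
Qed.

Definition unbroken l : R := \prod_(i < l) (1 - v i).

Lemma unbroken01 l : 0 <= unbroken l <= 1.
Proof.
elim: l => [|l IH]; first by rewrite /unbroken big_ord0 ler01 lexx.
rewrite /unbroken big_ord_recr /= -/(unbroken l).
by have := v01 l; nra.
Qed.

(** Each break adds a rounding error of at most one and contracts the former
    error. *)
Lemma remaining_approx l : `|(remaining l)%:R - n%:R * unbroken l| <= l%:R.
Proof.
elim: l => [|l IH]; first by rewrite /unbroken big_ord0 mulr1 subrr normr0.
rewrite /= natrB ?piece_le //; have := piece_approx (remaining l) (v01 l).
rewrite /unbroken big_ord_recr /= -/(unbroken l) -natr1.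
move: IH; have := v01 l; rewrite !ler_norml.
set a := (remaining l)%:R; set b := (piece _ _)%:R; set c := n%:R; set u := unbroken l; nra.
Qed.

Lemma cut_approx l : `|(cut l)%:R - n%:R * stick_breaking v l| <= l.+1%:R.
Proof.
rewrite /cut /stick_breaking -/(unbroken l) -natr1.
have := piece_approx (remaining l) (v01 l); have := remaining_approx l; have := v01 l.
rewrite !ler_norml.
set a := (remaining l)%:R; set b := (piece _ _)%:R; set c := n%:R; set u := unbroken l; nra.
Qed.

Lemma cut_tail L l : (L <= l)%N -> (cut l)%:R <= n%:R * unbroken L + L%:R.
Proof.
move=> Ll; apply: (@le_trans _ _ (remaining L)%:R).
  rewrite ler_nat; apply: leq_trans (piece_le _ _) _.
  elim: l Ll => [|l IH]; first by rewrite leqn0 => /eqP ->.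
  rewrite leq_eqVlt => /predU1P[<- //|]; rewrite ltnS => /IH; apply: leq_trans.
  exact: leq_subr.
by have := remaining_approx L; rewrite ler_norml; lra.
Qed.

End Fixed.

(** The order statistics are inverse to the counting function. *)
Lemma nth_sort_gt (x : seq nat) (t : R) j : 0 <= t ->
  (t < (nth 0%N (sort geq x) j)%:R) = (j < count (fun c : nat => t < c%:R)%R x)%N.
Proof.
move=> t0; rewrite -(seq.permP (permEl (perm_sort geq x))).
elim: (sort geq x) (sort_sorted geq_total x) j => [|c y IH] srt j /=.
  by rewrite nth_nil ltn0; apply/negbTE; rewrite -leNgt.
have {}IH := IH (path_sorted srt).
move: srt; rewrite /= (path_sortedE geq_trans) => /andP[/allP yc _].
case: (ltP t c%:R) => tc; first by case: j => [|j] //=; rewrite add1n ltnS -IH.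
have y0 : count (fun c : nat => t < c%:R) y = 0%N.
  apply/eqP; rewrite -leqn0 leqNgt -has_count; apply/hasPn => d /yc /= dc.
  by rewrite -leNgt; apply: le_trans tc; rewrite ler_nat.
rewrite y0 add0n; case: j => [|j] /=; last by rewrite IH y0 !ltn0.
by rewrite ltnn; apply/negbTE; rewrite -leNgt.
Qed.

End DiscreteSticks.

(** * Ordered pieces of a fixed stick *)

Local Open Scope classical_set_scope.
Local Open Scope ring_scope.

Section SortedLimit.
Context (R : realType) (v : nat -> R) (v01 : forall l, 0 <= v l <= 1).
Context (v_exhausts : forall e : R, 0 < e -> exists L, unbroken v L < e).
Context (D : nat -> R) (Ddec : nonincreasing_seq D).
Context (tau : nat -> nat) (tau_bij : bijective tau) (Dtau : D =1 stick_breaking v \o tau).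

(** The pieces of index [tau 0, ..., tau j] are eventually all above
    [n (D j - e)], hence so is the piece of rank [j]. *)
Lemma sorted_cuts_ge j (e : R) : 0 < e ->
  exists N, forall n, (N <= n)%N ->
    n%:R * (D j - e) <= (nth 0%N (sort geq (cuts n v n)) j)%:R.
Proof.
move=> e0; pose mx := (\max_(i < j.+1) tau i).+1.
exists (maxn mx (Num.Def.truncn (mx%:R / e)).+1) => n; rewrite geq_max => /andP[mn n_gt].
have mxn : mx%:R < n%:R * e.
  rewrite -ltr_pdivrMr //; apply: lt_le_trans (Num.Theory.truncnS_gt _) _.
  by rewrite ler_nat.
have [neg|nonneg] := ltP (n%:R * (D j - e)) 0; first by apply: le_trans (ltW neg) _.
have [gt|] := ltP (n%:R * (D j - e)) (nth 0%N (sort geq (cuts n v n)) j)%:R.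
  exact: ltW.
rewrite leNgt nth_sort_gt // => /negP; case.
pose s := [seq tau i | i <- iota 0 j.+1].
have <- : size s = j.+1 by rewrite size_map size_iota.
rewrite /cuts count_map -size_filter; apply: uniq_leq_size.
  by rewrite map_inj_uniq ?iota_uniq //; apply: bij_inj.
move=> x /mapP[i]; rewrite mem_iota add0n => /andP[_ ij] ->.
have tm : (tau i < mx)%N by rewrite ltnS (leq_bigmax (Ordinal ij)).
rewrite mem_filter mem_iota /= add0n (leq_trans tm mn) andbT.
have Dij : D j <= D i by apply: Ddec.
have := cut_approx n v01 (tau i); rewrite -[stick_breaking _ _]/((stick_breaking v \o tau) i) -Dtau.
have tm' : (tau i).+1%:R <= mx%:R :> R by rewrite ler_nat.
rewrite ler_norml; have : (0 : R) <= n%:R by [].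
set a := (cut _ _ _)%:R; set c := n%:R in mxn nonneg *.
set t := (_.+1)%:R in tm' *; nra.
Qed.

(** Pieces above [n (D j + e)] have bounded index, as little of the stick is left
    after [L] breaks; for large [n] they are then among the fewer than [j.+1]
    pieces of the continuous stick that exceed [D j]. *)
Lemma sorted_cuts_le j (e : R) : 0 < e ->
  exists N, forall n, (N <= n)%N ->
    (nth 0%N (sort geq (cuts n v n)) j)%:R <= n%:R * (D j + e).
Proof.
move=> e0; have e2 : 0 < e / 2 by rewrite divr_gt0.
have [L Le] := v_exhausts e2.
exists (Num.Def.truncn (L.+1%:R / (e / 2))).+1 => n n_gt.
have Ln : L.+1%:R < n%:R * (e / 2).
  rewrite -ltr_pdivrMr //; apply: lt_le_trans (Num.Theory.truncnS_gt _) _.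
  by rewrite ler_nat.
have D0 : 0 <= D j.
  rewrite Dtau /= /stick_breaking mulr_ge0 //; last by case/andP: (v01 (tau j)).
  by case/andP: (unbroken01 v01 (tau j)).
have n0 : 0 <= n%:R :> R by [].
rewrite leNgt nth_sort_gt; last by rewrite mulr_ge0 // addr_ge0 // ltW.
apply/negP => many.
have [tau' tauK tau'K] := tau_bij.
pose s := [seq tau i | i <- iota 0 j].
suff : (size [seq l <- iota 0 n | (n%:R * (D j + e) < (cut n v l)%:R)%R] <= size s)%N.
  by rewrite size_map size_iota size_filter leqNgt -(count_map (cut n v) (fun c : nat => n%:R * (D j + e) < c%:R)) many.
apply: uniq_leq_size; first by rewrite filter_uniq ?iota_uniq.
move=> l; rewrite mem_filter => /andP[big _].
have lL : (l < L)%N.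
  rewrite ltnNge; apply/negP => Ll; have := cut_tail n v01 Ll.
  move: big Ln Le; rewrite -natr1.
  set a := (cut _ _ _)%:R; set c := n%:R in n0 *; set u := unbroken v L; set ell := L%:R; nra.
have lL' : l.+1%:R <= L.+1%:R :> R by rewrite ler_nat ltnS ltnW.
have xl : D j < stick_breaking v l.
  have := cut_approx n v01 l; rewrite ler_norml.
  move: big Ln lL'; set a := (cut _ _ _)%:R; set c := n%:R in n0 *.
  set x := stick_breaking v l; set t := l.+1%:R; set ell := L.+1%:R => *.
  suff : 0 < c * (x - D j) by rewrite ltNge => /negP H; rewrite ltNge; apply/negP => xD; apply: H; nra.
  nra.
apply/mapP; exists (tau' l); rewrite ?tau'K // mem_iota /= add0n ltnNge; apply/negP => jl.
have := Ddec jl; rewrite Dtau /= tau'K; lra.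
Qed.

Lemma sorted_cuts_cvg j :
  (nth 0%N (sort geq (cuts n v n)) j)%:R / n%:R @[n --> \oo] --> D j.
Proof.
apply/cvgrPdist_le => e e0.
have [N1 H1] := sorted_cuts_ge j e0; have [N2 H2] := sorted_cuts_le j e0.
exists (maxn 1 (maxn N1 N2)) => // n /=; rewrite !geq_max => /and3P[n1 nN1 nN2].
have n0 : 0 < n%:R :> R by rewrite ltr0n.
rewrite ler_distlC; apply/andP; split.
  by rewrite ler_pdivlMr // mulrC H1.
by rewrite ler_pdivrMr // mulrC H2.
Qed.

End SortedLimit.

(** * Uniform breaking points *)

Section UniformPieces.
Context (R : realType).

Lemma uniform_ray (a : R) : 0 <= a <= 1 -> uniform_prob (@ltr01 R) `[a, +oo[ = (1 - a)%:E.
Proof.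
move=> /andP[a0 a1]; rewrite /uniform_prob integral_uniform_pdf.
have -> : `[a, +oo[%classic `&` `[0, 1]%classic = `[a, 1]%classic :> set R.
  apply/seteqP; split=> x /=; rewrite !in_itv /= ?andbT.
    by case=> ax /andP[_ x1]; rewrite ax.
  by case/andP => ax x1; rewrite ax x1 (le_trans a0 ax).
rewrite (eq_integral (fun=> 1%:E)); last first.
  move=> x; rewrite inE /= in_itv /= => /andP[ax x1].
  by rewrite /uniform_pdf x1 (le_trans a0 ax) subr0 invr1.
rewrite integral_cst //= mul1e lebesgue_measure_itv /= lte_fin.
have [//|a_gt1|->] := ltgtP a 1; [by move: a1; rewrite leNgt a_gt1|by rewrite subrr].
Qed.

(** For [N > 0] the events [piece N x = c] are differences of these rays. *)
Definition scaled_ray (N k : nat) : set R := [set x | (k <= Num.Def.truncn (N%:R * x))%N].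

Lemma scaled_rayE N k : (0 < N)%N -> scaled_ray N k.+1 = `[k.+1%:R / N%:R, +oo[%classic.
Proof.
move=> N0; apply/seteqP; split=> x /=; rewrite /scaled_ray /= in_itv /= andbT.
  by rewrite Num.Theory.truncn_gt_nat ler_pdivrMr ?ltr0n // mulrC.
by rewrite Num.Theory.truncn_gt_nat ler_pdivrMr ?ltr0n // mulrC.
Qed.

Lemma scaled_ray0 N : scaled_ray N 0 = setT.
Proof. by apply/seteqP; split=> x. Qed.

Lemma measurable_scaled_ray N k : (0 < N)%N -> measurable (scaled_ray N k).
Proof.
move=> N0; case: k => [|k]; first by rewrite scaled_ray0.
by rewrite scaled_rayE //; apply: measurable_itv.
Qed.

Lemma uniform_scaled_ray N k : (0 < N)%N -> (k <= N)%N ->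
  uniform_prob (@ltr01 R) (scaled_ray N k) = (1 - k%:R / N%:R)%:E.
Proof.
move=> N0; case: k => [|k] kN.
  by rewrite scaled_ray0 mul0r subr0; exact: probability_setT.
rewrite scaled_rayE // uniform_ray // divr_ge0 // ler_pdivrMr ?ltr0n //.
by rewrite mul1r ler_nat.
Qed.

Definition piece_set (N c : nat) : set R := [set x | piece N x = c].

Lemma piece_setE N c : (c <= N)%N ->
  piece_set N.+1 c.+1 = scaled_ray N.+1 c `\` (if (c < N)%N then scaled_ray N.+1 c.+1 else set0).
Proof.
move=> cN; rewrite /piece_set /piece /scaled_ray.
apply/seteqP; split=> x; rewrite /=; set t := Num.Def.truncn _.
  move=> [e]; case: ltnP => cN' /=; split=> //; first by lia.
  - by rewrite -/t; apply/negP; lia.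
  - by lia.
case: ltnP => cN' /= [ct]; rewrite -?/t => nct; congr S; last by lia.
by move/negP: nct; lia.
Qed.

Lemma measurable_piece_set N c : measurable (piece_set N c).
Proof.
case: N => [|N].
  have [->|c0] := eqVneq c 0%N.
    by rewrite (_ : piece_set _ _ = setT) //; apply/seteqP; split.
  rewrite (_ : piece_set _ _ = set0) //; apply/seteqP; split=> // x /= /esym e.
  by rewrite e in c0.
case: c => [|c]; first by rewrite (_ : piece_set _ _ = set0) //; apply/seteqP; split.
case: (leqP c N) => cN; last first.
  rewrite (_ : piece_set _ _ = set0) //; apply/seteqP; split=> // x /= [].
  by have := geq_minr (Num.Def.truncn (N.+1%:R * x)) N; lia.
rewrite piece_setE //; apply: measurableD; first exact: measurable_scaled_ray.
by case: ifP => _; [exact: measurable_scaled_ray|exact: measurable0].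
Qed.

Lemma uniform_piece_set N c :
  uniform_prob (@ltr01 R) (piece_set N c) = (piece_prob R N c)%:E.
Proof.
case: N => [|N] /=.
  have [->|c0] := eqVneq c 0%N.
    rewrite (_ : piece_set _ _ = setT); last by apply/seteqP; split.
    exact: probability_setT.
  rewrite (_ : piece_set _ _ = set0) ?measure0 //; apply/seteqP; split=> // x /= /esym e.
  by rewrite e in c0.
case: c => [|c].
  by rewrite (_ : piece_set _ _ = set0) ?measure0 ?mul0r //; apply/seteqP; split.
rewrite [(0 < c.+1 <= _)%N]/= ltnS; case: (leqP c N) => cN; last first.
  rewrite mul0r (_ : piece_set _ _ = set0) ?measure0 //; apply/seteqP; split=> // x /= [].
  by have := geq_minr (Num.Def.truncn (N.+1%:R * x)) N; lia.
have mr k : measurable (scaled_ray N.+1 k) by exact: measurable_scaled_ray.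
have fin : (uniform_prob (@ltr01 R) (scaled_ray N.+1 c) < +oo)%E.
  by rewrite uniform_scaled_ray ?ltry //; lia.
have mB : measurable (if (c < N)%N then @scaled_ray N.+1 c.+1 else set0).
  by case: ifP => _; [exact: mr|exact: measurable0].
rewrite piece_setE //.
transitivity (uniform_prob (@ltr01 R) (scaled_ray N.+1 c) - uniform_prob (@ltr01 R)
    (scaled_ray N.+1 c `&` (if (c < N)%N then scaled_ray N.+1 c.+1 else set0)))%E.
  exact: (measureD (mu := uniform_prob (@ltr01 R)) (mr c) mB fin).
have nz : N.+1%:R != 0 :> R by rewrite pnatr_eq0.
case: ltnP => cN'.
  have -> : scaled_ray N.+1 c `&` scaled_ray N.+1 c.+1 = scaled_ray N.+1 c.+1.
    by apply: setIidr => x; rewrite /scaled_ray /=; apply: ltnW.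
  rewrite !uniform_scaled_ray ?ltnS //; try lia.
  by rewrite -EFinB -[c.+1%:R]natr1 /=; congr EFin; field.
have -> : c = N by lia.
rewrite setI0 measure0 sube0 uniform_scaled_ray ?leqnSn //.
by congr EFin; move: nz; rewrite -natr1 /= => nz; field.
Qed.

End UniformPieces.

Section CutsLaw.
Context (d : measure_display) (T : measurableType d) (R : realType) (P : probability T R).
Context (V : nat -> {RV P >-> R}) (V_iid : iid_uniform01 V).

Lemma uniform_event i (B : set R) : measurable B ->
  P (V i @^-1` B) = uniform_prob (@ltr01 R) B.
Proof. by case: V_iid => _ /(_ i B). Qed.

Lemma measurable_event i (B : set R) : measurable B -> measurable (V i @^-1` B).
Proof. by move=> mB; rewrite -[X in measurable X]setTI; apply: measurable_funPT. Qed.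

Lemma range_event_prob L M (B : nat -> set R) : (forall i, measurable (B i)) ->
  P (\bigcap_(i in [set i | (L <= i < L + M)%N]) (V i @^-1` B i)) =
  (\prod_(i <- iota L M) uniform_prob (@ltr01 R) (B i))%E.
Proof.
move=> mB; have [/(_ [fset i in iota L M]%fset B mB) H _] := V_iid.
have -> : [set i | (L <= i < L + M)%N] = [set` [fset i in iota L M]%fset].
  by apply/seteqP; split=> i /=; rewrite !inE mem_iota.
rewrite H (perm_big (iota L M)) /=; last first.
  by apply: uniq_perm; rewrite ?fset_uniq ?iota_uniq // => i; rewrite !inE.
by apply: eq_bigr => i _; apply: uniform_event.
Qed.

Let letters x i := V i x.

(** Prescribing all pieces prescribes the remaining lengths, so the event is an
    intersection of conditions on the separate variables. *)
Lemma cuts_eventE n mu :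
  [set x | cuts n (letters x) (size mu) = mu] =
  \bigcap_(i in [set i | (0 <= i < 0 + size mu)%N])
    (V i @^-1` piece_set (n - sumn (take i mu)) (nth 0%N mu i)).
Proof.
apply/seteqP; split=> x /=.
  by move/(cuts_eqP _ _ (erefl (size mu))) => H i /= /H.
by move=> H; apply/(cuts_eqP _ _ (erefl (size mu))) => i i_lt; apply: H.
Qed.

Lemma measurable_cuts_event n mu : measurable [set x | cuts n (letters x) (size mu) = mu].
Proof.
rewrite cuts_eventE; apply: bigcap_measurableType => i _.
by apply: measurable_event; apply: measurable_piece_set.
Qed.

Lemma cuts_event_prob n mu :
  P [set x | cuts n (letters x) (size mu) = mu] = (pieces_prob R n mu)%:E.
Proof.
rewrite cuts_eventE range_event_prob; last by move=> i; apply: measurable_piece_set.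
rewrite (piece_prob_prod _ _ (erefl (size mu))).
rewrite -prodEFin -(big_mkord predT (fun l => (piece_prob R (n - sumn (take l mu)) (nth 0%N mu l))%:E)).
by rewrite /index_iota subn0; apply: eq_bigr => i _; apply: uniform_piece_set.
Qed.

Lemma size_cuts n v f : size (@cuts R n v f) = f.
Proof. by rewrite size_map size_iota. Qed.

Lemma bounded_lists_uniq M f : uniq (bounded_lists M f).
Proof.
elim: f => //= f IH; apply: (@allpairs_uniq _ _ _ (fun c mu => c :: mu) (iota 0 M.+1) (bounded_lists M f)) => //.
  exact: iota_uniq.
by move=> [a x] [b y] _ _ /= [-> ->].
Qed.

Lemma mem_bounded_lists M mu : all (fun c => c <= M)%N mu -> mu \in bounded_lists M (size mu).
Proof.
elim: mu => [|c mu IH] //= /andP[cM /IH mM].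
by apply: (@allpairs_f _ _ _ (fun c mu => c :: mu) (iota 0 M.+1)); rewrite // mem_iota.
Qed.

Lemma size_bounded_lists M f mu : mu \in bounded_lists M f -> size mu = f.
Proof.
elim: f mu => [|f IH] mu /=; first by rewrite inE => /eqP ->.
by move/(@allpairsP _ _ _ (fun c mu => c :: mu) (iota 0 M.+1)) => [[c x] /= [_ /IH <- ->]].
Qed.

Lemma cuts_le n v f : all (fun c => c <= n)%N (@cuts R n v f).
Proof.
apply/allP => _ /mapP[l _ ->]; apply: leq_trans (piece_le _ _) _.
by elim: l => //= l IH; apply: leq_trans (leq_subr _ _) IH.
Qed.

Lemma cuts_decomp n (F : seq nat -> R) x :
  F (cuts n (letters x) n) =
  \sum_(mu <- bounded_lists n n) F mu * \1_[set x | cuts n (letters x) (size mu) = mu] x.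
Proof.
set mu0 := cuts n (letters x) n.
have mu0_in : mu0 \in bounded_lists n n.
  by rewrite -{2}(size_cuts n (letters x) n); apply: mem_bounded_lists; apply: cuts_le.
rewrite (bigD1_seq mu0) ?bounded_lists_uniq //= indicE mem_set /= ?size_cuts //.
rewrite mulr1 big1_seq ?addr0 // => mu /andP[ne mu_in].
rewrite indicE memNset ?mulr0 //= (size_bounded_lists mu_in) => e.
by rewrite -e eqxx in ne.
Qed.

Lemma measurable_cuts n (F : seq nat -> R) :
  measurable_fun setT (fun x => F (cuts n (letters x) n)).
Proof.
rewrite (_ : (fun x => _) = fun x => \sum_(mu <- bounded_lists n n)
    F mu * \1_[set x | cuts n (letters x) (size mu) = mu] x); last first.
  by apply/funext => x; apply: cuts_decomp.
apply: measurable_sum => mu; apply: measurable_funM => //.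
by apply: measurable_indic; apply: measurable_cuts_event.
Qed.

(** Both sides are sums over the lists of pieces with the same weights, by
    independence on the left and by the recursion on the right. *)
Lemma integral_cuts n (F : seq nat -> R) : parts_invariant F ->
  (\int[P]_x (F (cuts n (letters x) n))%:E = (uniform_mean n F)%:E)%E.
Proof.
move=> Finv; rewrite (uniform_mean_pieces Finv (leqnn n) (leqnn n)).
under eq_integral => x _ do rewrite cuts_decomp -sumEFin.
rewrite integral_sum //=; last first.
  move=> mu; under eq_fun do rewrite EFinM; apply: integrableZl => //.
  apply: integrable_indic => //.
  exact: measurable_cuts_event.
rewrite -sumEFin; apply: eq_bigr => mu _.
under eq_integral => x _ do rewrite EFinM.
rewrite integralZl //=; last by apply: integrable_indic => //; exact: measurable_cuts_event.
rewrite integral_indic //; last exact: measurable_cuts_event.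
by rewrite setIT mulrC EFinM; congr (_ * _)%E; apply: cuts_event_prob.
Qed.

End CutsLaw.

(** * Almost sure convergence *)

(** Each index with [v l >= 1/2] halves what is left. *)
Lemma unbroken_small (R : realType) (v : nat -> R) :
  (forall l, 0 <= v l <= 1) -> (forall L, exists2 l, (L <= l)%N & 2^-1 <= v l) ->
  forall e : R, 0 < e -> exists L, unbroken v L < e.
Proof.
move=> v01 often e e0.
have mono L l : (L <= l)%N -> unbroken v l <= unbroken v L.
  elim: l => [|l IH]; first by rewrite leqn0 => /eqP ->.
  rewrite leq_eqVlt => /predU1P[<- //|]; rewrite ltnS => /IH; apply: le_trans.
  rewrite {1}/unbroken big_ord_recr /= -/(unbroken v l).
  by have := v01 l; have := unbroken01 v01 l; nra.
have halves k : exists L, unbroken v L <= 2^-1 ^+ k.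
  elim: k => [|k [L IH]]; first by exists 0%N; rewrite /unbroken big_ord0.
  have [l Ll vl] := often L; exists l.+1.
  rewrite /unbroken big_ord_recr /= -/(unbroken v l) exprS.
  by have := mono _ _ Ll; have := v01 l; have := unbroken01 v01 l; nra.
pose k := Num.Def.truncn e^-1; have [L Lk] := halves k; exists L.
apply: le_lt_trans Lk _; rewrite exprVn invf_plt ?posrE ?exprn_gt0 //.
apply: lt_le_trans (Num.Theory.truncnS_gt _) _; rewrite -/k -natrX ler_nat.
by rewrite ltn_expl.
Qed.

Section AlmostSure.
Context (d : measure_display) (T : measurableType d) (R : realType) (P : probability T R).
Context (V : nat -> {RV P >-> R}) (V_iid : iid_uniform01 V).

Lemma ae_unit_interval : {ae P, forall x, forall l, 0 <= V l x <= 1}.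
Proof.
apply: ae_foralln => l.
have mI : measurable (`[0, 1]%classic : set R) by exact: measurable_itv.
have PI : P (V l @^-1` `[0, 1]%classic) = 1%E.
  by rewrite (uniform_event V_iid l mI) /uniform_prob integral_uniform_pdf1.
have mE := measurable_event V l mI.
exists (~` (V l @^-1` `[0, 1]%classic)); split.
- exact: measurableC.
- by have := probability_setC P mE; rewrite PI subee // => ->.
- by apply: subsetC => x /=; rewrite in_itv.
Qed.

(** By independence, [M] consecutive variables lie below 1/2 with probability
    [2^-M]. *)
Lemma ae_often_large : {ae P, forall x, forall L, exists2 l, (L <= l)%N & 2^-1 <= V l x}.
Proof.
apply: ae_foralln => L.
have mB : measurable (`]-oo, 2^-1[%classic : set R) by exact: measurable_itv.
have PB : uniform_prob (@ltr01 R) `]-oo, 2^-1[%classic = 2^-1%:E.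
  have <- : ~` `[2^-1, +oo[%classic = `]-oo, 2^-1[%classic :> set R by exact: setCitvr.
  pose U : set R := `[2^-1, +oo[%classic.
  transitivity (1 - uniform_prob (@ltr01 R) U)%E.
    by apply: probability_setC; exact: measurable_itv.
  by rewrite uniform_ray; [rewrite -EFinB; congr EFin; lra|lra].
pose E M := \bigcap_(i in [set i | (L <= i < L + M)%N]) (V i @^-1` `]-oo, 2^-1[%classic).
have mE M : measurable (E M).
  by apply: bigcap_measurableType => i _; apply: measurable_event.
have PE M : P (E M) = (2^-1 ^+ M)%:E.
  rewrite (range_event_prob V_iid L M (fun=> mB)).
  under eq_bigr do rewrite PB.
  by rewrite big_const_seq count_predT size_iota iter_mule mule1 EFin_expe.
exists (\bigcap_M E M); split.
- by apply: bigcap_measurableType => M _.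
- apply/eqP; rewrite eq_le measure_ge0 andbT; apply/lee_addgt0Pr => e e0.
  rewrite add0e; pose k := Num.Def.truncn e^-1.
  apply: (@le_trans _ _ (P (E k))).
    by apply: le_measure; rewrite ?inE //; [apply: bigcap_measurableType => M _|apply: bigcap_inf].
  rewrite PE lee_fin; apply: ltW; rewrite exprVn invf_plt ?posrE ?exprn_gt0 //.
  apply: lt_le_trans (Num.Theory.truncnS_gt _) _; rewrite -/k -natrX ler_nat.
  by rewrite ltn_expl.
- move=> x /= none M _ i /= /andP[Li _]; rewrite in_itv /= ltNge; apply/negP => big.
  by apply: none; exists i.
Qed.

End AlmostSure.

Lemma row_cvg (R : realType) k (u : nat -> 'I_k -> R) (l : 'I_k -> R) :
  (forall j, u n j @[n --> \oo] --> l j) ->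
  (\row_j u n j : 'rV[R]_k) @[n --> \oo] --> (\row_j l j : 'rV[R]_k).
Proof.
move=> ul; apply/cvg_mx_entourageP => A entA.
have near_j : \forall n \near \oo, forall j : 'I_k, A (l j, u n j).
  apply: filter_forall => j.
  by move/cvg_entourageP: (ul j) => /(_ A entA).
by apply: filterS near_j => n An i j; rewrite !mxE inE.
Qed.

Section MeasurableComposition.
Context (d : measure_display) (T : measurableType d) (R : realType).

Lemma measurable_countable (C : countType) (z : T -> C) (G : C -> R) :
  (forall c, measurable [set x | z x = c]) -> measurable_fun setT (fun x => G (z x)).
Proof.
move=> mz _ Y mY; rewrite setTI.
have -> : (fun x => G (z x)) @^-1` Y =
    \bigcup_i oapp (fun c : C => if `[< Y (G c) >] then [set x | z x = c] else set0) set0 (choice.unpickle i).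
  apply/seteqP; split=> x /=.
    by move=> Yx; exists (choice.pickle (z x)) => //; rewrite choice.pickleK /= asboolT.
  by case=> i _; case: (choice.unpickle i) => //= c; case: asboolP => // Yc /= ->.
apply: bigcup_measurable => i _; case: (choice.unpickle i) => //= c.
by case: asboolP.
Qed.

(** Rounding the coordinates down to multiples of [1 / (N + 1)] makes the
    composition measurable, being a function of countably many values, and it
    converges as [N] grows by continuity. *)
Lemma measurable_continuous_row k (f : 'rV[R]_k -> R) (D : 'I_k -> T -> R) :
  continuous f -> (forall j, measurable_fun setT (D j)) ->
  measurable_fun setT (fun x => f (\row_j D j x)).
Proof.
move=> fc mD.
pose z N x : {ffun 'I_k -> int} := [ffun j => Num.floor (N.+1%:R * D j x)].
pose G N (c : {ffun 'I_k -> int}) : R := f (\row_j ((c j)%:~R / N.+1%:R)).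
apply: (@measurable_fun_cvg _ _ _ _ (fun N x => G N (z N x))).
  move=> N; apply: measurable_countable => c.
  have -> : [set x | z N x = c] = \bigcap_(j in setT)
      (D j @^-1` `[(c j)%:~R / N.+1%:R, (c j + 1)%:~R / N.+1%:R[%classic).
    have eqv j x : (Num.floor (N.+1%:R * D j x) == c j) =
        (D j x \in `[(c j)%:~R / N.+1%:R, (c j + 1)%:~R / N.+1%:R[).
      rewrite floor_eq in_itv /= ler_pdivrMr ?ltr0Sn // ltr_pdivlMr ?ltr0Sn //.
      by rewrite ![_ * N.+1%:R]mulrC.
    apply/seteqP; split=> x /=.
      by move=> zc j _ /=; rewrite -eqv -zc ffunE.
    by move=> H; apply/ffunP => j; rewrite ffunE; apply/eqP; rewrite eqv; apply: H.
  apply: fin_bigcap_measurable; first exact: finite_finset.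
  move=> j _; rewrite -[X in measurable X]setTI; apply: mD => //.
move=> x _; apply: (@cvg_comp _ _ _ _ f); last exact: fc.
apply: row_cvg => j; apply/cvgrPdist_le => e e0.
exists (Num.Def.truncn e^-1) => // N /= eN.
rewrite ffunE; set y := D j x; set t := N.+1%:R * y.
have N0 : 0 < N.+1%:R :> R by rewrite ltr0Sn.
have /andP[ft tf] := Num.Theory.floor_itv t.
have -> : y = t / N.+1%:R by rewrite /t mulrAC mulfV ?mul1r // gt_eqF.
rewrite -mulrBl normrM [X in _ * X]ger0_norm ?invr_ge0 ?ler0n // ler_pdivrMr //.
rewrite ger0_norm ?subr_ge0 //.
apply: (@le_trans _ _ 1); first by move: tf; rewrite intrD; lra.
rewrite -ler_pdivrMl // mulr1; apply: ltW.
by apply: lt_le_trans (Num.Theory.truncnS_gt _) _; rewrite ler_nat.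
Qed.

End MeasurableComposition.

(** * Limit theorems *)

Section Limits.
Context (R : realType) (k : nat).

Definition first_parts n (y : seq nat) : 'rV[R]_k := \row_(j < k) ((nth 0%N y j)%:R / n%:R).

Lemma cycle_vecE n (s : 'S_n) : cycle_vec R k s = first_parts n (cycle_type s).
Proof. by apply/rowP => j; rewrite !mxE. Qed.

Lemma first_parts_depends (A : Type) n (g : 'rV[R]_k -> A) x y :
  (forall j, (j < k)%N -> nth 0%N x j = nth 0%N y j) -> g (first_parts n x) = g (first_parts n y).
Proof. by move=> xy; congr g; apply/rowP => j; rewrite !mxE xy. Qed.

(** The cycle lengths have the law of the pieces cut with the variables [V i]; these
    converge almost surely to [D], and [f] is continuous and bounded. *)
Lemma uniform_cvg_in_law (d : measure_display) (T : measurableType d) (P : probability T R)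
    (D : nat -> {RV P >-> R}) :
  poisson_dirichlet1 D -> cycle_vec_cvg_in_law D k (@uniform_law R).
Proof.
move=> [V V_iid D_ae] f fc [M fM].
pose F n y := f (first_parts n (sort geq y)).
have FE n : \sum_(s : 'S_n) uniform_law R s * f (cycle_vec R k s) = uniform_mean n (F n).
  apply: eq_bigr => s _; rewrite /F cycle_vecE sorted_sort //; first exact: geq_trans.
  exact: (sort_sorted geq_total).
have Finv n : parts_invariant (F n).
  apply: (@parts_invariant_sort R k (fun y => f (first_parts n y))) => x y.
  exact: first_parts_depends.
rewrite expectation.unlock.
have -> : (fun n => (\sum_(s : 'S_n) uniform_law R s * f (cycle_vec R k s))%:E) =
    (fun n => \int[P]_x (F n (cuts n (fun i => V i x) n))%:E)%E.
  by apply/funext => n; rewrite FE (integral_cuts V_iid _ (Finv _)).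
have [|||||_ _ /=] := @dominated_convergence _ T R P setT measurableT
   (fun n x => (F n (cuts n (fun i => V i x) n))%:E) (fun x => (f (\row_(j < k) D j x))%:E)
   (fun=> M%:E); last by [].
- by move=> n; apply/measurable_EFinP; apply: (measurable_cuts V n (F n)).
- apply/measurable_EFinP.
  by apply: (@measurable_continuous_row _ T R k f (fun j : 'I_k => D j)).
- have := ae_unit_interval V_iid; have := ae_often_large V_iid.
  move: D_ae; apply: filterS3 => x [Ddec [tau tau_bij Dtau]] often v01 _.
  apply: cvg_EFin; first by near=> n.
  apply: (@cvg_comp _ _ _ _ f); last exact: fc.
  apply: row_cvg => j.
  exact: (sorted_cuts_cvg v01 (unbroken_small v01 often) Ddec tau_bij Dtau).
- exact: finite_measure_integrable_cst.
- by apply: aeW => x n _; rewrite lee_fin fM.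
Unshelve. all: by end_near. Qed.

End Limits.

Theorem corollary2p7 (R : realType) (p : R) (hp : 0 < p < 1)
    (k : nat) (hk : (1 <= k)%N) (m : nat -> nat) (hm : forall n, (0 < m n)%N) :
  (cdf_distance k (@shelf_law R p n (m n)) (@uniform_law R n) @[n --> \oo] --> (0 : R))
  /\
  (forall (d : measure_display) (T : measurableType d) (P : probability T R)
      (D : nat -> {RV P >-> R}), poisson_dirichlet1 D ->
    cycle_vec_cvg_in_law D k (fun n => @shelf_law R p n (m n)) /\
    cycle_vec_cvg_in_law D k (@uniform_law R)).
Proof.
split.
  apply/cvgrPdist_le => e e0.
  have [N close] := first_parts_close hp k e0.
  exists N => // n /= nN; rewrite sub0r normrN.
  have cdfE (law : 'S_n -> R) t : cycle_cdf law t = \sum_(s : 'S_n) law s *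
      [forall j : 'I_k, first_parts R k n (cycle_type s) ord0 j <= t ord0 j]%:R.
    rewrite /cycle_cdf big_mkcond /=; apply: eq_bigr => s _.
    by rewrite -cycle_vecE; case: ifP => _; rewrite ?mulr1 ?mulr0.
  rewrite /cdf_distance; set S := [set _ | _ in _].
  have Sle x : S x -> 0 <= x <= e.
    case=> t _ <-; rewrite normr_ge0 !cdfE /=.
    apply: (close n (m n) (fun y => [forall j : 'I_k, first_parts R k n y ord0 j <= t ord0 j]%:R)) => //.
      by move=> x' y'; apply: (@first_parts_depends R k R n
        (fun z => [forall j : 'I_k, z ord0 j <= t ord0 j]%:R)).
    by move=> y; rewrite ger0_norm ?ler0n // lern1; case: [forall j, _].
  have S0 : S `|cycle_cdf (@shelf_law R p n (m n)) (0 : 'rV[R]_k) - cycle_cdf (@uniform_law R n) (0 : 'rV[R]_k)|.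
    by exists (0 : 'rV[R]_k) => // j; rewrite mxE lexx ler01.
  have Sub : ubound S e by move=> x /Sle /andP[].
  rewrite ger0_norm; first by apply: ge_sup => //; eexists; exact: S0.
  have /andP[h0 _] := Sle _ S0.
  by apply: le_trans h0 (ub_le_sup _ S0); exists e.
move=> d T P D PD; have unif := @uniform_cvg_in_law R k _ _ _ _ PD; split=> // f fc fb.
have := unif f fc fb; have [M fM] := fb.
have M0 : 0 <= M by apply: le_trans (fM 0).
pose M' := M + 1; have M'0 : 0 < M' by rewrite ltr_wpDl.
set u := (fun n => (\sum_(s : 'S_n) uniform_law R s * _)%:E).
set w := (fun n => (\sum_(s : 'S_n) shelf_law p (m n) s * _)%:E).
suff diff : ((\sum_(s : 'S_n) shelf_law p (m n) s * f (cycle_vec R k s) -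
    \sum_(s : 'S_n) uniform_law R s * f (cycle_vec R k s))%:E : \bar R) @[n --> \oo] --> (0%:E : \bar R).
  move=> ul.
  have := cvgeD _ diff ul; rewrite add0e => wl.
  have {}wl := wl _.
  have -> : w = fun n => (((\sum_(s : 'S_n) shelf_law p (m n) s * f (cycle_vec R k s) -
    \sum_(s : 'S_n) uniform_law R s * f (cycle_vec R k s))%:E : \bar R) + u n)%E.
    by apply/funext => n; rewrite /u /w -EFinD subrK.
  by apply: wl; rewrite fin_num_adde_defr.
apply: cvg_EFin; first by near=> n.
apply/cvgrPdist_le => e e0 /=.
have eM : 0 < e / M' by rewrite divr_gt0.
have [N close] := first_parts_close hp k eM.
exists N => // n /= nN; rewrite sub0r normrN.
have := close n (m n) (fun y => f (first_parts R k n y) / M') nN (hm n).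
rewrite /shelf_mean /uniform_mean.
have scale (law : 'S_n -> R) : \sum_(s : 'S_n) law s * (f (first_parts R k n (cycle_type s)) / M') =
    (\sum_(s : 'S_n) law s * f (cycle_vec R k s)) / M'.
  by rewrite mulr_suml; apply: eq_bigr => s _; rewrite cycle_vecE mulrA.
rewrite !scale -mulrBl normrM [X in _ * X]ger0_norm ?invr_ge0 ?(ltW M'0) //.
rewrite ler_pM2r ?invr_gt0 //; apply.
  by move=> x y; apply: (@first_parts_depends R k R n (fun z => f z / M')).
move=> y; rewrite normrM [X in _ * X]ger0_norm ?invr_ge0 ?(ltW M'0) //.
by rewrite ler_pdivrMr // mul1r; apply: le_trans (fM _) _; rewrite lerDl.
Unshelve. all: by end_near. Qed.
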